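(* Let $\nu$ be a real number with $\nu>-1$ and let $q_\nu:\mathbb{D}\to\mathbb{C}$ be defined by $$q_{\nu}(z)=2^{\nu-1}\Gamma(\nu+1)z^{1-\frac{\nu}{2}}\left((2-\nu)J_{\nu}(\sqrt{z})+\sqrt{z}J_{\nu}'(\sqrt{z})\right)=\sum_{n\geq0}\frac{(-1)^n(n+1)\Gamma(\nu+1)z^{n+1}}{4^n\,n!\,\Gamma(\nu+n+1)}.$$ The function $q_\nu$ is starlike in $\mathbb{D}$ and all of its derivatives $q_\nu^{(k)}$, $k\geq 1$, are close-to-convex (and hence univalent) in $\mathbb{D}$ if and only if $\nu\geq\nu_\star$, where $\nu_\star\simeq-0.1438\dots$ is the unique root of the equation $$3J_{\nu}(1)+2(\nu-2)J_{\nu+1}(1)=0$$ (in the unknown $\nu$) on $(-1,\infty)$.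
   Context: $\mathbb{D}=\{z\in\mathbb{C}:|z|<1\}$ is the open unit disk. $J_\nu$ is the Bessel function of the first kind of order $\nu$, $J_\nu(z)=\sum_{n\ge0}\frac{(-1)^n}{n!\,\Gamma(\nu+n+1)}\left(\frac z2\right)^{2n+\nu}$, and $J_\nu'$ is its derivative with respect to $z$. The expression with $\sqrt z$ and $z^{1-\nu/2}$ is understood as the single-valued function given by the displayed power series (which is entire). Starlike means univalent on $\mathbb{D}$ with image starlike with respect to the origin. An analytic function $g$ on $\mathbb{D}$ (no normalization required) is close-to-convex if there is a convex univalent function $h$ on $\mathbb{D}$ (not necessarily normalized) with $\operatorname{Re}(g'(z)/h'(z))>0$ for all $z\in\mathbb{D}$. *)

(* Defs.v *)
(* Real and complex analysis over Stdlib's R and Coquelicot's C. *)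
From Stdlib Require Import Reals Factorial.
From Coquelicot Require Import Coquelicot.

Open Scope R_scope.

(** * Special functions *)

(* Only meaningful for 0 < x, where the improper integral converges. *)
Definition Gamma (x : R) : R :=
  RInt_gen (fun t => Rpower t (x - 1) * exp (- t))
           (at_right 0) (Rbar_locally p_infty).

(* Only meaningful for 0 < x (Rpower is the real power of a positive base) and
   -1 < nu (so that every Gamma is taken at a positive argument). *)
Definition BesselJ (nu x : R) : R :=
  Series (fun n => (-1) ^ n / (INR (fact n) * Gamma (nu + INR n + 1))
                   * Rpower (x / 2) (2 * INR n + nu)).

(* The sum of a complex series, taken componentwise. *)
Definition CSeries (a : nat -> C) : C :=
  (Series (fun n => Re (a n)), Series (fun n => Im (a n))).

Definition q_coef (nu : R) (n : nat) : R :=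
  (-1) ^ n * (INR n + 1) * Gamma (nu + 1)
  / (4 ^ n * INR (fact n) * Gamma (nu + INR n + 1)).

(* The series has infinite radius of convergence, so this is an entire function;
   it is the single-valued meaning of
   2^(nu-1) Gamma(nu+1) z^(1-nu/2) ((2-nu) J_nu(sqrt z) + sqrt z J_nu'(sqrt z)). *)
Definition q (nu : R) (z : C) : C :=
  CSeries (fun n => (RtoC (q_coef nu n) * z ^ (n + 1)%nat)%C).

(* The same expression at a positive real point, where the square root and the
   powers have no branch ambiguity. *)
Definition q_bessel (nu x : R) : R :=
  Rpower 2 (nu - 1) * Gamma (nu + 1) * Rpower x (1 - nu / 2)
  * ((2 - nu) * BesselJ nu (sqrt x) + sqrt x * Derive (BesselJ nu) (sqrt x)).

(** * Geometric function theory on the unit disk *)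

Definition unit_disk (z : C) : Prop := Cmod z < 1.

Definition analytic_on_disk (f : C -> C) : Prop :=
  forall z, unit_disk z -> @ex_derive C_AbsRing C_NormedModule f z.

Definition disk_image (f : C -> C) (w : C) : Prop :=
  exists z, unit_disk z /\ f z = w.

Definition univalent (f : C -> C) : Prop :=
  analytic_on_disk f /\
  forall z1 z2, unit_disk z1 -> unit_disk z2 -> f z1 = f z2 -> z1 = z2.

Definition starlike_set (A : C -> Prop) : Prop :=
  forall (w : C) (t : R), A w -> 0 <= t <= 1 -> A (RtoC t * w)%C.

Definition convex_set (A : C -> Prop) : Prop :=
  forall (w1 w2 : C) (t : R), A w1 -> A w2 -> 0 <= t <= 1 ->
    A (RtoC (1 - t) * w1 + RtoC t * w2)%C.

Definition starlike (f : C -> C) : Prop :=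
  univalent f /\ starlike_set (disk_image f).

Definition convex_univalent (h : C -> C) : Prop :=
  univalent h /\ convex_set (disk_image h).

(* C_derive is a total function that agrees with the complex derivative wherever
   the latter exists, in particular on the disk for the analytic g and h here.
   A zero of C_derive h is excluded, since Coquelicot's quotient by 0 is 0. *)
Definition close_to_convex (g : C -> C) : Prop :=
  analytic_on_disk g /\
  exists h : C -> C, convex_univalent h /\
    forall z, unit_disk z -> 0 < Re (C_derive g z / C_derive h z)%C.

Definition C_derive_n (f : C -> C) (k : nat) : C -> C := Nat.iter k C_derive f.

(* Main.v *)
Require Import Defs.
From Stdlib Require Import Reals Ranalysis5 Lra Lia Psatz Factorial.
From Stdlib Require Import ClassicalEpsilon Classical FunctionalExtensionality.
From Coquelicot Require Import Coquelicot.

(** Write [mu = nu + 1] and [t_n = (-1/4)^n / (n! (mu)_n)], where [(mu)_n] is the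
    rising factorial.  The functional equation of Gamma turns the coefficients of
    [q] into [(n + 1) t_n], and those of [q'] into [(n + 1)^2 t_n].  The heart
    of the theorem is that the stated properties of [q] hold together exactly when
    [q'(1) >= 0].

    Necessity is a fact about the real line: [q'(0) = 1], so if [q'(1) < 0] then
    [q] increases near [0] and decreases near [1], and takes some value twice on
    [[0,1)] ([injective_derivative_at_1_nonneg]).

    For sufficiency, note that [q'(1) >= 0] forces [mu >= 17/20]. In this range
    the coefficients decay so fast that, after the constant term, the linear
    term of [q'] and of [p = q / z] dominates the rest, even with the weights
    [n^2]. Since [0 <= 1 - Re z^n <= n^2 (1 - Re z)] on the disk, the real parts
    of [q'] and [p] are larger than their values at [1], which are non-negative
    ([linear_dominated_Re]). Since [|Im z^n| <= n |Im z|], their imaginary parts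
    both have the sign of [- Im z] ([linear_dominated_Im]). So [Re q' > 0],
    which gives univalence by the Noshiro-Warschawski theorem, and [Re (q' *
    conj p) = Re q' Re p + Im q' Im p > 0], which is the starlikeness condition
    [Re (z q' / q) > 0]. In the derivatives of order at least [2] the constant
    term alone dominates, so [q^(k)] for [k >= 1] is close-to-convex with
    respect to a multiple of the identity.

    The geometric criteria ([noshiro_warschawski], [starlike_image]) rest on the
    openness of holomorphic maps with non-vanishing derivative.  It is obtained by
    minimising [|f - w|] on a closed disk, for which differentiability at each
    point is enough.

    Finally, the Bessel equation is [q'(1) = 0] up to a positive factor
    ([bessel_equation_q_derivative]), and [mu q'(1) = mu - 1 + tail], where the
    tail is a contraction in [mu]: this is increasing in [mu], so it has one zero,
    which is located by evaluating four terms of the tail. *)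

(** * Complex differentiability in epsilon-delta form *)

Definition C_diff (f : C -> C) (z l : C) : Prop :=
  forall eps, 0 < eps -> exists delta, 0 < delta /\
    forall y, Cmod (y - z) < delta ->
      Cmod (f y - f z - (y - z) * l) <= eps * Cmod (y - z).

Lemma is_derive_C_diff (f : C -> C) (z l : C) :
  is_derive f z l <-> C_diff f z l.
Proof.
split.
- intros [_ Hd] eps Heps.
  destruct (Hd z (fun P HP => HP) (mkposreal eps Heps)) as [d Hloc].
  exists d; split; [apply cond_pos|].
  intros y Hy. exact (Hloc y Hy).
- intros Hd; split.
  + apply (is_linear_scal_l (V := C_NormedModule)).
  + intros x Hx.
    apply (@is_filter_lim_locally_unique) in Hx. subst x.
    intros eps.
    destruct (Hd eps (cond_pos eps)) as [d [Hd0 Hdd]].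
    exists (mkposreal d Hd0). intros y Hy. exact (Hdd y Hy).
Qed.

Lemma Re_minus (x y : C) : Re (x - y) = Re x - Re y.
Proof. reflexivity. Qed.
Lemma Im_minus (x y : C) : Im (x - y) = Im x - Im y.
Proof. reflexivity. Qed.

Lemma im_le_Cmod (c : C) : Rabs (Im c) <= Cmod c.
Proof.
eapply Rle_trans; [apply (Rmax_r (Rabs (fst c))) | apply Rmax_Cmod].
Qed.

Lemma Cmod_le_re_im (c : C) : Cmod c <= Rabs (Re c) + Rabs (Im c).
Proof.
apply Rsqr_incr_0_var.
- pose proof (Cmod2_alt c) as Hc. unfold Rsqr.
  pose proof (Rabs_pos (Re c)) as Hp1. pose proof (Rabs_pos (Im c)) as Hp2.
  pose proof (pow2_abs (Re c)) as Hs1. pose proof (pow2_abs (Im c)) as Hs2. nra.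
- pose proof (Rabs_pos (Re c)) as Hp1. pose proof (Rabs_pos (Im c)) as Hp2. lra.
Qed.

Lemma Cmod_le_split (a b : C) : Cmod a <= Cmod (a - b) + Cmod b.
Proof.
replace a with ((a - b) + b)%C at 1 by ring. apply Cmod_triangle.
Qed.

Lemma Cmod_sym (a b : C) : Cmod (a - b) = Cmod (b - a).
Proof.
rewrite <- Cmod_opp. f_equal. ring.
Qed.

Lemma C_diff_continuous (f : C -> C) (z l : C) :
  C_diff f z l ->
  forall eps, 0 < eps -> exists delta, 0 < delta /\
    forall y, Cmod (y - z) < delta -> Cmod (f y - f z) < eps.
Proof.
intros Hd eps Heps.
destruct (Hd 1 Rlt_0_1) as [d [Hd0 Hdd]].
pose proof (Cmod_ge_0 l) as Hl.
exists (Rmin d (eps / (2 + Cmod l))). split.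
- apply Rmin_pos; [assumption|]. apply Rdiv_lt_0_compat; lra.
- intros y Hy.
  assert (Hy1 : Cmod (y - z) < d) by (eapply Rlt_le_trans; [exact Hy|apply Rmin_l]).
  assert (Hy2 : Cmod (y - z) < eps / (2 + Cmod l)) by (eapply Rlt_le_trans; [exact Hy|apply Rmin_r]).
  apply (Rmult_lt_compat_r (2 + Cmod l)) in Hy2; [|lra].
  replace (eps / (2 + Cmod l) * (2 + Cmod l)) with eps in Hy2 by (field; lra).
  specialize (Hdd y Hy1).
  pose proof (Cmod_le_split (f y - f z) ((y - z) * l)) as Ht.
  rewrite Cmod_mult in Ht.
  pose proof (Cmod_ge_0 (y - z)). nra.
Qed.

Lemma C_diff_scal (c z : C) : C_diff (fun z => (c * z)%C) z c.
Proof.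
intros eps Heps. exists 1. split; [lra|]. intros y _.
replace (c * y - c * z - (y - z) * c)%C with (RtoC 0) by ring.
rewrite Cmod_0. pose proof (Cmod_ge_0 (y - z)). nra.
Qed.

(** * Minima on closed disks and local surjectivity *)

(** The functions to minimise are only controlled on the closed disk, so
    continuity is asked at its points only; a gauge that avoids the disk is used
    elsewhere.  If the infimum [L] were not attained, every point would have a
    gauge [d] with [phi > L + d] near it, and by compactness one gauge would do
    for the whole disk. *)
Lemma min_on_closed_disk (phi : C -> R) (c : C) (r : R) :
  0 <= r ->
  (forall m, Cmod (m - c) <= r -> 0 <= phi m) ->
  (forall m, Cmod (m - c) <= r -> forall eps, 0 < eps ->
     exists delta, 0 < delta /\
       forall y, Cmod (y - m) < delta -> Cmod (y - c) <= r ->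
         phi m - eps < phi y) ->
  exists m, Cmod (m - c) <= r /\ forall y, Cmod (y - c) <= r -> phi m <= phi y.
Proof.
intros Hr Hpos Hcont.
set (E := fun x => exists y, Cmod (y - c) <= r /\ x = - phi y).
destruct (completeness E) as [L' [HLub HLleast]].
{ exists 0. intros x [y [Hy ->]]. specialize (Hpos y Hy). lra. }
{ exists (- phi c), c. split; [|reflexivity].
  replace (c - c)%C with (RtoC 0) by ring. rewrite Cmod_0. exact Hr. }
set (L := - L').
assert (HL : forall y, Cmod (y - c) <= r -> L <= phi y).
{ intros y Hy. assert (- phi y <= L') by (apply HLub; exists y; auto).
  unfold L; lra. }
apply NNPP; intros Hno.
assert (HLs : forall y, Cmod (y - c) <= r -> L < phi y).
{ intros y Hy. destruct (HL y Hy) as [H|H]; [exact H|].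
  exfalso; apply Hno. exists y; split; [exact Hy|]. intros y' Hy'.
  rewrite <- H; auto. }
set (P := fun (m : C) (d : posreal) => forall y, Cmod (y - c) <= r ->
   Rabs (Re y - Re m) < d -> Rabs (Im y - Im m) < d -> L + d < phi y).
assert (HP : forall m, exists d, P m d).
{ intros m. destruct (Rle_lt_dec (Cmod (m - c)) r) as [Hm|Hm].
  - specialize (HLs m Hm).
    assert (He : 0 < (phi m - L) / 2) by lra.
    destruct (Hcont m Hm _ He) as [d [Hd Hdd]].
    assert (Hd' : 0 < Rmin (d / 2) ((phi m - L) / 2)) by (apply Rmin_pos; lra).
    exists (mkposreal _ Hd'). intros y Hy H1 H2; simpl in *.
    pose proof (Rmin_l (d / 2) ((phi m - L) / 2)).
    pose proof (Rmin_r (d / 2) ((phi m - L) / 2)).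
    assert (Hym : Cmod (y - m) < d).
    { eapply Rle_lt_trans; [apply Cmod_le_re_im|].
      rewrite Re_minus, Im_minus. lra. }
    specialize (Hdd y Hym Hy). lra.
  - assert (Hd' : 0 < (Cmod (m - c) - r) / 2) by lra.
    exists (mkposreal _ Hd'). intros y Hy H1 H2; simpl in *. exfalso.
    assert (Hym : Cmod (y - m) < Cmod (m - c) - r).
    { eapply Rle_lt_trans; [apply Cmod_le_re_im|].
      rewrite Re_minus, Im_minus. lra. }
    pose proof (Cmod_le_split (m - c) (y - c)) as Ht.
    replace (m - c - (y - c))%C with (- (y - m))%C in Ht by ring.
    rewrite Cmod_opp in Ht. lra. }
set (delta := fun u v => proj1_sig (constructive_indefinite_description _ (HP (u, v)))).
assert (Hdelta : forall u v, P (u, v) (delta u v)).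
{ intros u v. unfold delta. apply proj2_sig. }
destruct (compactness_value_2d (Re c - r) (Re c + r) (Im c - r) (Im c + r) delta)
  as [d Hd].
assert (Hall : forall y, Cmod (y - c) <= r -> L + d < phi y).
{ intros y Hy. apply NNPP; intros Hn.
  pose proof (re_le_Cmod (y - c)) as H1. pose proof (im_le_Cmod (y - c)) as H2.
  rewrite Re_minus in H1. rewrite Im_minus in H2.
  apply (Hd (Re y) (Im y)).
  - apply Rabs_le_between'. lra.
  - apply Rabs_le_between'. lra.
  - intros (u & v & _ & _ & Hu & Hv & Hle).
    apply Hn. specialize (Hdelta u v y Hy Hu Hv). lra. }
assert (L' <= - L - d).
{ apply HLleast. intros x [y [Hy ->]]. specialize (Hall y Hy). lra. }
pose proof (cond_pos d). unfold L in *. lra.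
Qed.

Lemma C_diff_min_on_closed_disk (f f' : C -> C) (w c : C) (r : R) :
  0 <= r ->
  (forall z, Cmod (z - c) <= r -> C_diff f z (f' z)) ->
  exists m, Cmod (m - c) <= r /\
    forall y, Cmod (y - c) <= r -> Cmod (f m - w) <= Cmod (f y - w).
Proof.
intros Hr Hf.
apply (min_on_closed_disk (fun z => Cmod (f z - w)) c r Hr).
- intros; apply Cmod_ge_0.
- intros m Hm eps Heps.
  destruct (C_diff_continuous _ _ _ (Hf m Hm) eps Heps) as [d [Hd Hdd]].
  exists d; split; [exact Hd|]. intros y Hy _. specialize (Hdd y Hy).
  pose proof (Cmod_le_split (f m - w) (f y - w)) as Ht.
  replace (f m - w - (f y - w))%C with (- (f y - f m))%C in Ht by ring.
  rewrite Cmod_opp in Ht. lra.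
Qed.

(** Moving from [z] in the direction [- (f z - w) / f' z] decreases [|f - w|] to
    first order: this is the minimum modulus principle. *)
Lemma modulus_not_minimal (f : C -> C) (z l w : C) (r : R) :
  C_diff f z l -> l <> 0 -> f z <> w -> 0 < r ->
  exists y, Cmod (y - z) < r /\ Cmod (f y - w) < Cmod (f z - w).
Proof.
intros Hd Hl Hw Hr.
set (v := (- (f z - w) / l)%C).
assert (Hu : 0 < Cmod (f z - w)).
{ apply Cmod_gt_0. intros H. apply Hw.
  replace (f z) with ((f z - w) + w)%C by ring. rewrite H. ring. }
assert (Hl0 : 0 < Cmod l) by (apply Cmod_gt_0; exact Hl).
assert (Hv : Cmod v * Cmod l = Cmod (f z - w)).
{ rewrite <- Cmod_mult, <- (Cmod_opp (f z - w)). f_equal. unfold v. field. exact Hl. }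
assert (Hv0 : 0 < Cmod v) by (pose proof (Cmod_ge_0 v); nra).
destruct (Hd (Cmod l / 2)) as [d [Hd0 Hdd]]; [lra|].
(* a step that stays within [d] and [r] of [z] *)
set (t := Rmin (1 / 2) (Rmin (d / (2 * Cmod v)) (r / (2 * Cmod v)))).
assert (Ht : 0 < t).
{ unfold t. repeat apply Rmin_pos; try lra; apply Rdiv_lt_0_compat; lra. }
assert (Ht1 : t <= 1 / 2) by apply Rmin_l.
assert (Htd : t * Cmod v <= d / 2).
{ apply Rle_trans with (d / (2 * Cmod v) * Cmod v); [|right; field; lra].
  apply Rmult_le_compat_r; [lra|]. unfold t.
  eapply Rle_trans; [apply Rmin_r|apply Rmin_l]. }
assert (Htr : t * Cmod v <= r / 2).
{ apply Rle_trans with (r / (2 * Cmod v) * Cmod v); [|right; field; lra].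
  apply Rmult_le_compat_r; [lra|]. unfold t.
  eapply Rle_trans; [apply Rmin_r|apply Rmin_r]. }
exists (z + RtoC t * v)%C.
assert (Hm : Cmod (z + RtoC t * v - z) = t * Cmod v).
{ replace (z + RtoC t * v - z)%C with (RtoC t * v)%C by ring.
  rewrite Cmod_mult, Cmod_R, Rabs_pos_eq; lra. }
split; [lra|].
assert (Hlt : Cmod (z + RtoC t * v - z) < d) by lra.
specialize (Hdd _ Hlt). rewrite Hm in Hdd.
pose proof (Cmod_le_split (f (z + RtoC t * v)%C - w) (RtoC (1 - t) * (f z - w))) as Hs.
rewrite Cmod_mult, Cmod_R, (Rabs_pos_eq (1 - t)) in Hs by lra.
replace (f (z + RtoC t * v)%C - w - RtoC (1 - t) * (f z - w))%C
  with (f (z + RtoC t * v)%C - f z - (z + RtoC t * v - z) * l)%C in Hs.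
2:{ rewrite RtoC_minus. unfold v. field. exact Hl. }
nra.
Qed.

(** On a small closed disk [|f - w|] has a minimum.  It is interior when [w] is
    close to [f z0], and then it must be a zero by [modulus_not_minimal]. *)
Lemma local_surjectivity (f f' : C -> C) (z0 : C) (rho : R) :
  (forall z, Cmod (z - z0) < rho -> C_diff f z (f' z) /\ f' z <> 0) ->
  0 < rho ->
  exists delta, 0 < delta /\
    forall w, Cmod (w - f z0) < delta -> exists z, Cmod (z - z0) < rho /\ f z = w.
Proof.
intros Hf Hrho.
assert (Hz0 : Cmod (z0 - z0) < rho).
{ replace (z0 - z0)%C with (RtoC 0) by ring. rewrite Cmod_0. exact Hrho. }
destruct (Hf z0 Hz0) as [Hd Hl].
assert (Hl0 : 0 < Cmod (f' z0)) by (apply Cmod_gt_0; exact Hl).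
destruct (Hd (Cmod (f' z0) / 2)) as [d [Hd0 Hdd]]; [lra|].
set (r := Rmin (d / 2) (rho / 2)).
assert (Hr : 0 < r) by (apply Rmin_pos; lra).
assert (Hr1 : r <= d / 2) by apply Rmin_l.
assert (Hr2 : r <= rho / 2) by apply Rmin_r.
assert (Hbd : forall y, Cmod (y - z0) = r -> Cmod (f' z0) / 2 * r <= Cmod (f y - f z0)).
{ intros y Hy. assert (Hyd : Cmod (y - z0) < d) by lra.
  specialize (Hdd y Hyd).
  pose proof (Cmod_le_split ((y - z0) * f' z0) (f y - f z0)) as Ht.
  rewrite Cmod_mult, (Cmod_sym _ (f y - f z0)) in Ht. rewrite Hy in *. lra. }
exists (Cmod (f' z0) / 4 * r). split; [nra|].
intros w Hw.
destruct (C_diff_min_on_closed_disk f f' w z0 r) as [m [Hm Hmin]]; [lra| |].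
{ intros z Hz. apply Hf. lra. }
exists m. split; [lra|].
apply NNPP; intros Hne.
destruct Hm as [Hm|Hm].
- destruct (Hf m) as [Hdm Hlm]; [lra|].
  destruct (modulus_not_minimal f m (f' m) w (r - Cmod (m - z0)) Hdm Hlm Hne)
    as [y [Hy Hlt]]; [lra|].
  assert (Hy' : Cmod (y - z0) <= r).
  { pose proof (Cmod_le_split (y - z0) (m - z0)) as Ht.
    replace (y - z0 - (m - z0))%C with (y - m)%C in Ht by ring. lra. }
  specialize (Hmin y Hy'). lra.
- (* on the boundary circle [f] is too far from [w] *)
  assert (Hz : Cmod (z0 - z0) <= r).
  { replace (z0 - z0)%C with (RtoC 0) by ring. rewrite Cmod_0. lra. }
  specialize (Hmin z0 Hz). specialize (Hbd m Hm).
  pose proof (Cmod_le_split (f m - f z0) (w - f z0)) as Ht.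
  replace (f m - f z0 - (w - f z0))%C with (f m - w)%C in Ht by ring.
  rewrite (Cmod_sym (f z0) w) in Hmin. lra.
Qed.

Lemma disk_local_surjectivity (f f' : C -> C) (z0 : C) (eps : R) :
  (forall z, unit_disk z -> C_diff f z (f' z) /\ f' z <> 0) ->
  unit_disk z0 -> 0 < eps ->
  exists delta, 0 < delta /\
    forall w, Cmod (w - f z0) < delta ->
      exists z, unit_disk z /\ Cmod (z - z0) < eps /\ f z = w.
Proof.
intros Hf Hz0 Heps. unfold unit_disk in *.
assert (Hin : forall z, Cmod (z - z0) < Rmin eps (1 - Cmod z0) -> Cmod z < 1).
{ intros z Hz. pose proof (Cmod_le_split z z0). 
  pose proof (Rmin_r eps (1 - Cmod z0)). lra. }
destruct (local_surjectivity f f' z0 (Rmin eps (1 - Cmod z0))) as [d [Hd Hdd]].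
{ intros z Hz. apply Hf. auto. }
{ apply Rmin_pos; lra. }
exists d. split; [exact Hd|]. intros w Hw.
destruct (Hdd w Hw) as [z [Hz Hfz]]. exists z. split; [auto|].
split; [|exact Hfz]. eapply Rlt_le_trans; [exact Hz|apply Rmin_l].
Qed.

(** The chain rule for [g] composed with a local inverse of [f].  The local
    inverse is only used through the existence of a point [y] above each [w]. *)
Lemma chain_rule_local_inverse (f f' g : C -> C) (z l : C) (eta : R) :
  (forall z, unit_disk z -> C_diff f z (f' z) /\ f' z <> 0) ->
  unit_disk z -> C_diff g z l -> 0 < eta ->
  exists delta, 0 < delta /\ forall w, Cmod (w - f z) < delta ->
    exists y, unit_disk y /\ f y = w /\
      Cmod (g y - g z - (w - f z) * (l / f' z)) <= eta * Cmod (w - f z).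
Proof.
intros Hf Hz Hg Heta.
destruct (Hf z Hz) as [Hd Hl].
assert (Hl0 : 0 < Cmod (f' z)) by (apply Cmod_gt_0; exact Hl).
pose proof (Cmod_ge_0 (l / f' z)) as HK.
set (m := Cmod (f' z)) in *. set (K := Cmod (l / f' z)) in *.
(* with [d = y - z], both Taylor remainders are at most [eta1 * |d|], and
   [|d| <= 2 |w - f z| / m] *)
set (eta1 := Rmin (m / 2) (eta * m / (2 * (1 + K)))).
assert (He1 : 0 < eta1).
{ apply Rmin_pos; [lra|]. apply Rdiv_lt_0_compat; nra. }
assert (He1m : eta1 <= m / 2) by apply Rmin_l.
assert (He1e : eta1 * (1 + K) <= eta * m / 2).
{ apply Rle_trans with (eta * m / (2 * (1 + K)) * (1 + K)).
  - apply Rmult_le_compat_r; [lra|apply Rmin_r].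
  - right. field. lra. }
destruct (Hd eta1 He1) as [d1 [Hd1 Hf1]].
destruct (Hg eta1 He1) as [d2 [Hd2 Hg2]].
destruct (disk_local_surjectivity f f' z (Rmin d1 d2) Hf Hz) as [delta [Hdelta Hsur]].
{ apply Rmin_pos; lra. }
exists delta. split; [exact Hdelta|]. intros w Hw.
destruct (Hsur w Hw) as [y [Hy [Hyz Hfy]]].
exists y. split; [exact Hy|]. split; [exact Hfy|].
pose proof (Rmin_l d1 d2). pose proof (Rmin_r d1 d2).
assert (Ey1 : Cmod (y - z) < d1) by lra.
assert (Ey2 : Cmod (y - z) < d2) by lra.
specialize (Hf1 y Ey1). specialize (Hg2 y Ey2). rewrite Hfy in Hf1.
pose proof (Cmod_ge_0 (y - z)) as Hd0.
assert (Hdb : Cmod (y - z) * m <= 2 * Cmod (w - f z)).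
{ pose proof (Cmod_le_split ((y - z) * f' z) (w - f z)) as Ht.
  rewrite Cmod_mult, (Cmod_sym _ (w - f z)) in Ht. fold m in Ht. nra. }
replace (g y - g z - (w - f z) * (l / f' z))%C
  with ((g y - g z - (y - z) * l) - (w - f z - (y - z) * f' z) * (l / f' z))%C
  by (field; exact Hl).
pose proof (Cmod_triangle (g y - g z - (y - z) * l)
  (- ((w - f z - (y - z) * f' z) * (l / f' z)))) as Ht.
rewrite Cmod_opp, Cmod_mult in Ht. fold K in Ht.
assert (Cmod (w - f z - (y - z) * f' z) * K <= eta1 * Cmod (y - z) * K)
  by (apply Rmult_le_compat_r; lra).
eapply Rle_trans; [exact Ht|].
apply Rle_trans with ((eta1 * (1 + K)) * Cmod (y - z)); [lra|].
apply Rle_trans with (eta * m / 2 * Cmod (y - z)); [apply Rmult_le_compat_r; lra|].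
nra.
Qed.

(** * Univalence of close-to-convex functions *)

(** The supremum of the points [t] with [phi a < phi t] can only be [b]. *)
Lemma locally_increasing_lt (phi : R -> R) (a b : R) :
  a < b ->
  (forall t, a <= t <= b -> exists delta, 0 < delta /\
     forall s, a <= s <= b -> Rabs (s - t) < delta ->
       (s < t -> phi s < phi t) /\ (t < s -> phi t < phi s)) ->
  phi a < phi b.
Proof.
intros Hab Hloc.
set (E := fun t => a <= t <= b /\ (t = a \/ phi a < phi t)).
destruct (completeness E) as [c [Hub Hleast]].
{ exists b. intros t [Ht _]. lra. }
{ exists a. split; [lra|now left]. }
assert (Hac : a <= c) by (apply Hub; split; [lra|now left]).
assert (Hcb : c <= b) by (apply Hleast; intros t [Ht _]; lra).
destruct (Hloc c (conj Hac Hcb)) as [d [Hd Hdd]].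
assert (HEc : E c).
{ split; [lra|]. apply NNPP; intros Hn.
  assert (Hc' : c <= c - d); [|lra].
  apply Hleast. intros t [Ht Hphi]. apply Rnot_lt_le; intros Htc.
  assert (Hle : t <= c) by (apply Hub; split; auto).
  apply Hn. destruct (Req_dec t c) as [->|Hne]; [exact Hphi|right].
  destruct (Hdd t Ht) as [Hdd1 _]; [apply Rabs_def1; lra|].
  assert (phi t < phi c) by (apply Hdd1; lra).
  destruct Hphi as [->|Hphi]; lra. }
destruct Hcb as [Hcb|Hcb].
- exfalso. set (s := Rmin b (c + d / 2)).
  assert (Hs : c < s) by (apply Rmin_glb_lt; lra).
  assert (Hs1 : s <= b) by apply Rmin_l.
  assert (Hs2 : s <= c + d / 2) by apply Rmin_r.
  destruct (Hdd s) as [_ Hdd2]; [lra|apply Rabs_def1; lra|].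
  specialize (Hdd2 Hs).
  assert (s <= c); [|lra].
  apply Hub. split; [lra|]. right. destruct HEc as [_ [->|HE]]; lra.
- subst c. destruct HEc as [_ [HE|HE]]; lra.
Qed.

Lemma Cdiv_0_r (x : C) : (x / 0)%C = RtoC 0.
Proof.
unfold Cdiv, Cinv, Cmult, RtoC, Rdiv. simpl. f_equal; ring.
Qed.

(** Noshiro-Warschawski over the convex domain [h D]: along the preimage under
    [h] of the segment from [h z1] to [h z2], the component of [g] in the
    direction of that segment has derivative [Re (g' / h') > 0], so it is
    strictly increasing. *)
Lemma noshiro_warschawski (g h g' h' : C -> C) :
  (forall z, unit_disk z -> C_diff g z (g' z)) ->
  (forall z, unit_disk z -> C_diff h z (h' z)) ->
  (forall z1 z2, unit_disk z1 -> unit_disk z2 -> h z1 = h z2 -> z1 = z2) ->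
  convex_set (disk_image h) ->
  (forall z, unit_disk z -> 0 < Re (g' z / h' z)) ->
  forall z1 z2, unit_disk z1 -> unit_disk z2 -> g z1 = g z2 -> z1 = z2.
Proof.
intros Hg Hh Hinj Hconv Hre z1 z2 Hz1 Hz2 Heq.
assert (Hh' : forall z, unit_disk z -> C_diff h z (h' z) /\ h' z <> 0).
{ intros z Hz; split; [auto|]. intros H0. specialize (Hre z Hz).
  rewrite H0, Cdiv_0_r in Hre. simpl in Hre. lra. }
apply NNPP; intros Hne.
set (om := (h z2 - h z1)%C).
assert (Hom : om <> 0).
{ intros H0. apply Hne, Hinj; auto.
  replace (h z2) with (om + h z1)%C by (unfold om; ring). rewrite H0. ring. }
assert (Hom0 : 0 < Cmod om) by (apply Cmod_gt_0; exact Hom).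
assert (Hpath : forall t, exists z, 0 <= t <= 1 ->
  unit_disk z /\ h z = (h z1 + RtoC t * om)%C).
{ intros t. destruct (classic (0 <= t <= 1)) as [Ht|Ht].
  - destruct (Hconv (h z1) (h z2) t) as [z [Hz Hhz]]; auto; try (eexists; eauto; fail).
    exists z. intros _. split; [exact Hz|]. rewrite Hhz, RtoC_minus. unfold om. ring.
  - exists z1. intros; contradiction. }
set (gam := fun t => proj1_sig (constructive_indefinite_description _ (Hpath t))).
assert (Hgam : forall t, 0 <= t <= 1 ->
  unit_disk (gam t) /\ h (gam t) = (h z1 + RtoC t * om)%C).
{ intros t. unfold gam. apply proj2_sig. }
assert (H0 : gam 0 = z1).
{ destruct (Hgam 0) as [Ha Hb]; [lra|]. apply Hinj; auto. rewrite Hb. ring. }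
assert (H1 : gam 1 = z2).
{ destruct (Hgam 1) as [Ha Hb]; [lra|]. apply Hinj; auto. rewrite Hb. unfold om. ring. }
assert (Hlt : Re (g (gam 0) / om) < Re (g (gam 1) / om)).
2:{ rewrite H0, H1, Heq in Hlt. lra. }
apply (locally_increasing_lt (fun t => Re (g (gam t) / om))); [lra|].
intros t Ht. destruct (Hgam t Ht) as [Hz Hhz].
set (z := gam t) in *. set (kap := Re (g' z / h' z)).
assert (Hkap : 0 < kap) by (apply Hre; exact Hz).
destruct (chain_rule_local_inverse h h' g z (g' z) (kap / 2) Hh' Hz (Hg z Hz))
  as [d [Hd Hdd]]; [lra|].
exists (d / Cmod om). split; [apply Rdiv_lt_0_compat; lra|].
intros s Hs Hst. destruct (Hgam s Hs) as [Hzs Hhzs].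
assert (Hdel : (h (gam s) - h z)%C = (RtoC (s - t) * om)%C).
{ rewrite Hhzs, Hhz, RtoC_minus. ring. }
assert (Hmod : Cmod (h (gam s) - h z) = Rabs (s - t) * Cmod om)
  by (rewrite Hdel, Cmod_mult, Cmod_R; reflexivity).
destruct (Hdd (h (gam s))) as [y [Hy [Hfy Hb]]].
{ rewrite Hmod. apply (Rmult_lt_compat_r (Cmod om)) in Hst; [|lra].
  replace (d / Cmod om * Cmod om) with d in Hst by (field; lra). exact Hst. }
apply Hinj in Hfy; auto. subst y.
rewrite Hmod in Hb.
assert (Hre2 : Rabs (Re (g (gam s) / om) - Re (g z / om) - (s - t) * kap)
                 <= kap / 2 * Rabs (s - t)).
{ replace (Re (g (gam s) / om) - Re (g z / om) - (s - t) * kap)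
    with (Re ((g (gam s) - g z - (h (gam s) - h z) * (g' z / h' z)) / om)).
  - eapply Rle_trans; [apply re_le_Cmod|]. rewrite Cmod_div by exact Hom.
    apply Rmult_le_reg_r with (Cmod om); [lra|].
    replace (Cmod (g (gam s) - g z - (h (gam s) - h z) * (g' z / h' z)) / Cmod om * Cmod om)
      with (Cmod (g (gam s) - g z - (h (gam s) - h z) * (g' z / h' z))) by (field; lra).
    lra.
  - rewrite Hdel.
    replace ((g (gam s) - g z - RtoC (s - t) * om * (g' z / h' z)) / om)%C
      with (g (gam s) / om - g z / om - RtoC (s - t) * (g' z / h' z))%C
      by (field; split; [apply Hh'; exact Hz|exact Hom]).
    rewrite !Re_minus. f_equal. unfold kap, Cmult, RtoC, Re. simpl. ring. }
apply Rabs_le_between' in Hre2.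
split; intros Hlt.
- rewrite Rabs_left in Hre2 by lra. nra.
- rewrite Rabs_pos_eq in Hre2 by lra. nra.
Qed.

Lemma close_to_convex_univalent (g : C -> C) :
  close_to_convex g -> univalent g.
Proof.
intros [Hg [h [[[Hh Hinj] Hconv] Hre]]].
split; [exact Hg|].
apply (noshiro_warschawski g h (C_derive g) (C_derive h)); auto.
- intros z Hz. apply is_derive_C_diff, C_derive_correct; [exact z|auto].
- intros z Hz. apply is_derive_C_diff, C_derive_correct; [exact z|auto].
Qed.

(** * A criterion for starlikeness *)

Lemma Cmod_sqr_add (z d : C) :
  Cmod (z + d) ^ 2 = Cmod z ^ 2 + 2 * Re (Cconj z * d) + Cmod d ^ 2.
Proof.
rewrite !Cmod2_alt. unfold Cconj, Cplus, Cmult, Re, Im. simpl. ring.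
Qed.

(** When [f z] is shrunk to [(1 - tau) * f z], the preimage moves
    by about [- tau * f z / f' z], whose component along [z] is negative by
    hypothesis, so the preimage comes closer to the origin. *)
Lemma shrink_value_shrinks_preimage (f f' : C -> C) (z : C) :
  (forall z, unit_disk z -> C_diff f z (f' z) /\ f' z <> 0) ->
  unit_disk z -> 0 < Re (f z * Cconj (z * f' z)) ->
  exists delta, 0 < delta /\ forall tau, 0 < tau < delta ->
    exists y, Cmod y <= Cmod z /\ f y = (RtoC (1 - tau) * f z)%C.
Proof.
intros Hf Hz Hpos.
destruct (Hf z Hz) as [Hd Hl].
assert (Hl0 : 0 < Cmod (f' z)) by (apply Cmod_gt_0; exact Hl).
assert (Hu : 0 < Cmod (f z)).
{ apply Cmod_gt_0; intros H0. rewrite H0, Cmult_0_l in Hpos. simpl in Hpos. lra. }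
set (kap := Re (Cconj z * (f z / f' z))).
assert (Hkap : 0 < kap).
{ assert (He : Re (f z * Cconj (z * f' z)) = kap * Cmod (f' z) ^ 2).
  { unfold kap.
    replace (f z) with ((f z / f' z) * f' z)%C at 1 by (field; exact Hl).
    set (v := (f z / f' z)%C). rewrite Cmod2_alt.
    unfold Cconj, Cmult, Re, Im. simpl. ring. }
  rewrite He in Hpos. assert (0 < Cmod (f' z) ^ 2) by (apply pow_lt; lra). nra. }
set (u := Cmod (f z)) in *.
assert (Hid : C_diff (fun z => z) z 1).
{ intros eps Heps. exists 1. split; [lra|]. intros y _.
  replace (y - z - (y - z) * 1)%C with (RtoC 0) by ring. rewrite Cmod_0.
  pose proof (Cmod_ge_0 (y - z)). nra. }
destruct (chain_rule_local_inverse f f' (fun z => z) z 1 (kap / (2 * u)) Hf Hz Hid)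
  as [d [Hd0 Hdd]].
{ apply Rdiv_lt_0_compat; lra. }
set (M := u / Cmod (f' z) + kap / 2).
assert (HM : 0 < M).
{ unfold M. assert (0 < u / Cmod (f' z)) by (apply Rdiv_lt_0_compat; lra). lra. }
exists (Rmin (d / u) (kap / M ^ 2)). split.
{ apply Rmin_pos; apply Rdiv_lt_0_compat; try lra. apply pow_lt; lra. }
intros tau [Ht Htd].
assert (Ht1 : tau * u < d).
{ apply Rlt_le_trans with (d / u * u); [|right; field; lra].
  apply Rmult_lt_compat_r; [lra|]. eapply Rlt_le_trans; [exact Htd|apply Rmin_l]. }
assert (HM2 : 0 < M ^ 2) by (apply pow_lt; lra).
assert (Ht2 : tau * M ^ 2 < kap).
{ apply Rlt_le_trans with (kap / M ^ 2 * M ^ 2); [|right; field; lra].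
  apply Rmult_lt_compat_r; [lra|]. eapply Rlt_le_trans; [exact Htd|apply Rmin_r]. }
assert (Hdel : (RtoC (1 - tau) * f z - f z)%C = (- (RtoC tau * f z))%C)
  by (rewrite RtoC_minus; ring).
assert (Hmod : Cmod (RtoC (1 - tau) * f z - f z) = tau * u).
{ rewrite Hdel, Cmod_opp, Cmod_mult, Cmod_R, Rabs_pos_eq by lra. reflexivity. }
destruct (Hdd (RtoC (1 - tau) * f z)%C) as [y [Hy [Hfy Hb]]].
{ rewrite Hmod. exact Ht1. }
exists y. split; [|exact Hfy].
rewrite Hmod, Hdel in Hb.
set (e := (y - z - - (RtoC tau * f z) * (1 / f' z))%C) in Hb.
assert (Hb' : Cmod e <= kap / 2 * tau).
{ eapply Rle_trans; [exact Hb|]. right. field. lra. }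
assert (Hyz : y = (z + (e - RtoC tau * (f z / f' z)))%C) by (unfold e; field; exact Hl).
assert (Hmd : Cmod (e - RtoC tau * (f z / f' z)) <= tau * M).
{ pose proof (Cmod_triangle e (- (RtoC tau * (f z / f' z)))) as H.
  rewrite Cmod_opp, Cmod_mult, Cmod_R, Rabs_pos_eq, Cmod_div in H by (lra || exact Hl).
  unfold M. fold u in H. unfold Cminus. lra. }
assert (Hdot : Re (Cconj z * (e - RtoC tau * (f z / f' z)))
               <= kap / 2 * tau - tau * kap).
{ replace (Re (Cconj z * (e - RtoC tau * (f z / f' z))))
    with (Re (Cconj z * e) - tau * kap).
  2:{ unfold kap, Cminus, Cmult, Cplus, Copp, RtoC, Re. simpl. ring. }
  pose proof (re_le_Cmod (Cconj z * e)) as H. rewrite Cmod_mult, Cmod_conj in H.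
  apply Rabs_le_between in H. unfold unit_disk in Hz.
  pose proof (Cmod_ge_0 e). nra. }
apply Rsqr_incr_0_var; [|apply Cmod_ge_0].
rewrite !Rsqr_pow2, Hyz, Cmod_sqr_add.
pose proof (Cmod_ge_0 (e - RtoC tau * (f z / f' z))) as Hge.
assert (Cmod (e - RtoC tau * (f z / f' z)) ^ 2 <= (tau * M) ^ 2)
  by (apply pow_incr; lra).
rewrite Rpow_mult_distr in H. nra.
Qed.

(** For [w = f z0], the values [t * w] taken on the closed disk of radius [|z0|]
    form a closed set of [t], which by the previous lemma is open to the left
    away from [0]; hence it contains [[0,1]]. *)
Lemma starlike_image (f f' : C -> C) :
  (forall z, unit_disk z -> C_diff f z (f' z) /\ f' z <> 0) ->
  f 0 = 0 ->
  (forall z, unit_disk z -> z <> 0 -> 0 < Re (f z * Cconj (z * f' z))) ->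
  starlike_set (disk_image f).
Proof.
intros Hf H00 Hpos w s [z0 [Hz0 Hw]] Hs.
set (r := Cmod z0). unfold unit_disk in Hz0. fold r in Hz0.
set (S := fun t => s <= t /\ exists z, Cmod z <= r /\ f z = (RtoC t * w)%C).
assert (Hr : 0 <= r) by apply Cmod_ge_0.
assert (HS1 : S 1).
{ split; [lra|]. exists z0; split; [unfold r; lra|]. rewrite Hw. ring. }
destruct (completeness (fun x => S (- x))) as [c' [Hub Hleast]].
{ exists (- s). intros x [Hx _]. lra. }
{ exists (- (1)). rewrite Ropp_involutive. exact HS1. }
set (c := - c').
assert (Hc1 : forall t, S t -> c <= t).
{ intros t Ht. assert (- t <= c'); [|unfold c; lra].
  apply Hub. rewrite Ropp_involutive. exact Ht. }
assert (Hsc : s <= c).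
{ assert (c' <= - s); [|unfold c; lra]. apply Hleast. intros x [Hx _]. lra. }
assert (HSc : S c).
{ split; [exact Hsc|].
  destruct (C_diff_min_on_closed_disk f f' (RtoC c * w) 0 r Hr) as [m [Hm Hmin]].
  { intros z Hz. apply Hf. unfold unit_disk. replace (z - 0)%C with z in Hz by ring. lra. }
  replace (m - 0)%C with m in Hm by ring.
  exists m. split; [exact Hm|]. apply NNPP; intros Hne.
  assert (Hmu : 0 < Cmod (f m - RtoC c * w)).
  { apply Cmod_gt_0. intros H. apply Hne.
    replace (f m) with (f m - RtoC c * w + RtoC c * w)%C by ring. rewrite H. ring. }
  set (mu := Cmod (f m - RtoC c * w)) in *.
  pose proof (Cmod_ge_0 w) as Hw0.
  assert (Hc' : c' <= c' - mu / (1 + Cmod w)).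
  { apply Hleast. intros x [Hx [z [Hz Hfz]]]. apply Rnot_lt_le; intros Hlt.
    assert (Hcx : c <= - x) by (apply Hc1; split; eauto).
    specialize (Hmin z). replace (z - 0)%C with z in Hmin by ring. specialize (Hmin Hz).
    rewrite Hfz in Hmin.
    replace (RtoC (- x) * w - RtoC c * w)%C with (RtoC (- x - c) * w)%C in Hmin
      by (rewrite RtoC_minus; ring).
    rewrite Cmod_mult, Cmod_R, Rabs_pos_eq in Hmin by lra. fold mu in Hmin.
    assert (H : - x - c < mu / (1 + Cmod w)) by (unfold c in *; lra).
    apply (Rmult_lt_compat_r (1 + Cmod w)) in H; [|lra].
    replace (mu / (1 + Cmod w) * (1 + Cmod w)) with mu in H by (field; lra).
    nra. }
  assert (0 < mu / (1 + Cmod w)) by (apply Rdiv_lt_0_compat; lra). lra. }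
destruct HSc as [_ [z [Hz Hfz]]].
destruct Hsc as [Hsc|Hsc].
2:{ rewrite <- Hsc in Hfz. exists z. split; [unfold unit_disk; lra|exact Hfz]. }
destruct (classic (w = 0)) as [Hw0|Hw0].
{ exists 0. split; [unfold unit_disk; rewrite Cmod_0; lra|]. rewrite H00, Hw0. ring. }
assert (Hzu : unit_disk z) by (unfold unit_disk; lra).
assert (Hzn : z <> 0).
{ intros H. rewrite H, H00 in Hfz.
  assert (Hcw : Cmod (RtoC c * w) = 0) by (rewrite <- Hfz; apply Cmod_0).
  rewrite Cmod_mult, Cmod_R, Rabs_pos_eq in Hcw by lra.
  assert (0 < Cmod w) by (apply Cmod_gt_0; exact Hw0). nra. }
destruct (shrink_value_shrinks_preimage f f' z Hf Hzu (Hpos z Hzu Hzn)) as [d [Hd Hdd]].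
exfalso.
set (tau := Rmin (d / 2) ((c - s) / c)).
assert (Htau : 0 < tau) by (apply Rmin_pos; [lra|apply Rdiv_lt_0_compat; lra]).
assert (Htau2 : tau <= d / 2) by apply Rmin_l.
assert (Htau3 : tau * c <= c - s).
{ apply Rle_trans with ((c - s) / c * c); [|right; field; lra].
  apply Rmult_le_compat_r; [lra|apply Rmin_r]. }
destruct (Hdd tau) as [y [Hy Hfy]]; [lra|].
assert (Hlt : c <= c - tau * c).
{ apply Hc1. split; [lra|]. exists y. split; [lra|].
  rewrite Hfy, Hfz. rewrite !RtoC_minus, RtoC_mult. ring. }
nra.
Qed.

(** * Entire power series with real coefficients *)

Definition CPSeries (a : nat -> R) (z : C) : C :=
  CSeries (fun n => (RtoC (a n) * z ^ n)%C).

Definition entire (a : nat -> R) : Prop := CV_radius a = p_infty.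

Lemma Re_RtoC_mult (x : R) (z : C) : Re (RtoC x * z) = x * Re z.
Proof. unfold Cmult, RtoC, Re. simpl. ring. Qed.

Lemma Im_RtoC_mult (x : R) (z : C) : Im (RtoC x * z) = x * Im z.
Proof. unfold Cmult, RtoC, Im. simpl. ring. Qed.

Lemma Re_CPSeries (a : nat -> R) (z : C) :
  Re (CPSeries a z) = Series (fun n => a n * Re (z ^ n)).
Proof.
unfold CPSeries, CSeries. simpl. apply Series_ext. intros n. apply Re_RtoC_mult.
Qed.

Lemma Im_CPSeries (a : nat -> R) (z : C) :
  Im (CPSeries a z) = Series (fun n => a n * Im (z ^ n)).
Proof.
unfold CPSeries, CSeries. simpl. apply Series_ext. intros n. apply Im_RtoC_mult.
Qed.

Lemma Series_zero (a : nat -> R) : (forall n, a n = 0) -> Series a = 0.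
Proof.
intros Ha. rewrite (Series_ext a (fun n => 0 * a n)).
- rewrite Series_scal_l. ring.
- intros n. rewrite Ha. ring.
Qed.

Lemma CPSeries_RtoC (a : nat -> R) (x : R) :
  CPSeries a (RtoC x) = RtoC (PSeries a x).
Proof.
apply injective_projections; simpl; [apply Series_ext|apply Series_zero];
  intros n; rewrite <- RtoC_pow; simpl; ring.
Qed.

Lemma entire_ex_series_abs (a : nat -> R) (r : R) :
  entire a -> 0 <= r -> ex_series (fun n => Rabs (a n) * r ^ n).
Proof.
intros Ha Hr.
apply ex_series_ext with (fun n => Rabs (a n * r ^ n)).
- intros n. rewrite Rabs_mult, (Rabs_pos_eq (r ^ n)) by now apply pow_le. reflexivity.
- apply CV_disk_inside. unfold entire in Ha. rewrite Ha. exact I.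
Qed.

Lemma ex_series_le_R (a b : nat -> R) :
  (forall n, Rabs (a n) <= b n) -> ex_series b -> ex_series a.
Proof. exact (ex_series_le a b). Qed.

Lemma Rabs_Re_pow_le (z : C) (n : nat) (r : R) :
  Cmod z <= r -> Rabs (Re (z ^ n)) <= r ^ n.
Proof.
intros Hz. eapply Rle_trans; [apply re_le_Cmod|]. rewrite Cmod_pow.
apply pow_incr. split; [apply Cmod_ge_0|exact Hz].
Qed.

Lemma Rabs_Im_pow_le (z : C) (n : nat) (r : R) :
  Cmod z <= r -> Rabs (Im (z ^ n)) <= r ^ n.
Proof.
intros Hz. eapply Rle_trans; [apply im_le_Cmod|]. rewrite Cmod_pow.
apply pow_incr. split; [apply Cmod_ge_0|exact Hz].
Qed.

Lemma ex_series_entire_mult (a b : nat -> R) (r : R) :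
  entire a -> 0 <= r -> (forall n, Rabs (b n) <= r ^ n) ->
  ex_series (fun n => a n * b n).
Proof.
intros Ha Hr Hb. apply ex_series_le_R with (fun n => Rabs (a n) * r ^ n).
- intros n. rewrite Rabs_mult. apply Rmult_le_compat_l; [apply Rabs_pos|apply Hb].
- now apply entire_ex_series_abs.
Qed.

Lemma ex_series_entire_at_1 (a : nat -> R) :
  entire a -> ex_series (fun n => a n * 1 ^ n).
Proof.
intros Ha. apply (ex_series_entire_mult a (fun n => 1 ^ n) 1 Ha); [lra|].
intros n. rewrite pow1, Rabs_R1. lra.
Qed.

Lemma ex_series_Re (a : nat -> R) (z : C) :
  entire a -> ex_series (fun n => a n * Re (z ^ n)).
Proof.
intros Ha. apply (ex_series_entire_mult a _ (Cmod z)); auto using Cmod_ge_0.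
intros n. apply Rabs_Re_pow_le, Rle_refl.
Qed.

Lemma ex_series_Im (a : nat -> R) (z : C) :
  entire a -> ex_series (fun n => a n * Im (z ^ n)).
Proof.
intros Ha. apply (ex_series_entire_mult a _ (Cmod z)); auto using Cmod_ge_0.
intros n. apply Rabs_Im_pow_le, Rle_refl.
Qed.

Lemma Cmod_CSeries_le (e : nat -> C) (b : nat -> R) :
  (forall n, Cmod (e n) <= b n) -> ex_series b ->
  Cmod (CSeries e) <= 2 * Series b.
Proof.
intros He Hb.
eapply Rle_trans; [apply Cmod_le_re_im|]. simpl.
assert (Hre : forall n, Rabs (Re (e n)) <= b n)
  by (intros n; eapply Rle_trans; [apply re_le_Cmod|apply He]).
assert (Him : forall n, Rabs (Im (e n)) <= b n)
  by (intros n; eapply Rle_trans; [apply im_le_Cmod|apply He]).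
assert (Hs : forall u : nat -> R, (forall n, Rabs (u n) <= b n) ->
  Rabs (Series u) <= Series b).
{ intros u Hu. eapply Rle_trans; [apply Series_Rabs|].
  - apply ex_series_le_R with b; [|exact Hb]. intros n. rewrite Rabs_Rabsolu. apply Hu.
  - apply Series_le; [|exact Hb]. intros n. split; [apply Rabs_pos|apply Hu]. }
pose proof (Hs _ Hre). pose proof (Hs _ Him). lra.
Qed.

Lemma pow_remainder_bound (z h : C) (R0 : R) (n : nat) :
  1 <= R0 -> Cmod z <= R0 -> Cmod (z + h) <= R0 ->
  Cmod ((z + h) ^ S n - z ^ S n - RtoC (INR (S n)) * z ^ n * h)
    <= INR n ^ 2 * R0 ^ n * Cmod h ^ 2.
Proof.
intros HR Hz Hzh. induction n as [|n IH].
- replace ((z + h) ^ 1 - z ^ 1 - RtoC (INR 1) * z ^ 0 * h)%C with (RtoC 0).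
  + rewrite Cmod_0. simpl. lra.
  + simpl. ring.
- replace ((z + h) ^ S (S n) - z ^ S (S n) - RtoC (INR (S (S n))) * z ^ S n * h)%C
    with ((z + h) * ((z + h) ^ S n - z ^ S n - RtoC (INR (S n)) * z ^ n * h)
          + RtoC (INR (S n)) * z ^ n * (h * h))%C.
  2:{ rewrite (S_INR (S n)), RtoC_plus, !Cpow_S. ring. }
  eapply Rle_trans; [apply Cmod_triangle|].
  rewrite !Cmod_mult, Cmod_R, (Rabs_pos_eq (INR (S n))), Cmod_pow by apply pos_INR.
  pose proof (Cmod_ge_0 h) as Hh. pose proof (Cmod_ge_0 (z + h)) as Hzh0.
  pose proof (pos_INR n) as Hn.
  assert (Hp : 0 < R0 ^ n) by (apply pow_lt; lra).
  assert (Hzn : Cmod z ^ n <= R0 ^ n)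
    by (apply pow_incr; split; [apply Cmod_ge_0|exact Hz]).
  assert (Hzn0 : 0 <= Cmod z ^ n) by (apply pow_le, Cmod_ge_0).
  pose proof (pow2_ge_0 (Cmod h)) as Hh2.
  apply Rle_trans with
    (R0 * (INR n ^ 2 * R0 ^ n * Cmod h ^ 2) + INR (S n) * R0 ^ n * (Cmod h * Cmod h)).
  + apply Rplus_le_compat.
    * apply Rmult_le_compat; auto using Cmod_ge_0.
    * apply Rmult_le_compat_r; [nra|]. apply Rmult_le_compat_l; [apply pos_INR|exact Hzn].
  + rewrite S_INR. change (R0 ^ S n) with (R0 * R0 ^ n).
    set (H2 := Cmod h ^ 2) in *. replace (Cmod h * Cmod h) with H2 by (unfold H2; ring).
    assert (0 <= R0 ^ n * H2) by nra.
    replace (R0 * (INR n ^ 2 * R0 ^ n * H2) + (INR n + 1) * R0 ^ n * H2)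
      with ((R0 ^ n * H2) * (R0 * INR n ^ 2 + (INR n + 1))) by ring.
    replace ((INR n + 1) ^ 2 * (R0 * R0 ^ n) * H2)
      with ((R0 ^ n * H2) * (R0 * (INR n + 1) ^ 2)) by ring.
    apply Rmult_le_compat_l; [assumption|]. nra.
Qed.

Lemma INR_sqr_le_pow4 (n : nat) : INR n ^ 2 <= 4 ^ n.
Proof.
induction n as [|n IH]; [simpl; lra|].
destruct n as [|n]; [simpl; lra|].
rewrite (S_INR (S n)). change (4 ^ S (S n)) with (4 * 4 ^ S n).
assert (1 <= INR (S n)) by (rewrite S_INR; pose proof (pos_INR n); lra). nra.
Qed.

Lemma entire_derive (a : nat -> R) : entire a -> entire (PS_derive a).
Proof. unfold entire. now rewrite CV_radius_derive. Qed.

Lemma entire_incr_1 (a : nat -> R) : entire a -> entire (PS_incr_1 a).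
Proof. unfold entire. now rewrite CV_radius_incr_1. Qed.

Lemma Series_minus3 (a b c : nat -> R) :
  ex_series a -> ex_series b -> ex_series c ->
  Series a - Series b - Series c = Series (fun n => a n - b n - c n).
Proof.
intros Ha Hb Hc.
rewrite (Series_minus (fun n => a n - b n) c), (Series_minus a b); auto.
apply (ex_series_minus (V := R_NormedModule)); assumption.
Qed.

(** The Taylor remainder is at most [|h|^2] times a constant, namely twice
    [sum n^2 |a_(n+1)| R0^n], on any disk of radius [R0]. *)
Lemma CPSeries_C_diff (a : nat -> R) (z : C) :
  entire a -> C_diff (CPSeries a) z (CPSeries (PS_derive a) z).
Proof.
intros Ha eps Heps.
set (R0 := Cmod z + 1).
pose proof (Cmod_ge_0 z) as Hz0.
set (b := fun n => INR n ^ 2 * Rabs (a (S n)) * R0 ^ n).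
assert (Hb : ex_series b).
{ assert (Hs : ex_series (fun n => Rabs (PS_decr_1 a n) * (4 * R0) ^ n)).
  { apply entire_ex_series_abs; [|unfold R0; lra].
    unfold entire. rewrite CV_radius_decr_1. exact Ha. }
  apply ex_series_le_R with (2 := Hs). intros n. unfold b, PS_decr_1.
  assert (Hp : 0 <= R0 ^ n) by (apply pow_le; unfold R0; lra).
  pose proof (Rabs_pos (a (S n))) as Hap. pose proof (pow2_ge_0 (INR n)) as Hn.
  assert (Hprod : 0 <= Rabs (a (S n)) * R0 ^ n) by nra.
  rewrite Rabs_pos_eq by nra.
  rewrite Rpow_mult_distr.
  replace (INR n ^ 2 * Rabs (a (S n)) * R0 ^ n)
    with ((Rabs (a (S n)) * R0 ^ n) * INR n ^ 2) by ring.
  replace (Rabs (a (S n)) * (4 ^ n * R0 ^ n))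
    with ((Rabs (a (S n)) * R0 ^ n) * 4 ^ n) by ring.
  apply Rmult_le_compat_l; [exact Hprod|apply INR_sqr_le_pow4]. }
set (B := Series b).
assert (HB : 0 <= B).
{ unfold B. rewrite <- (Series_zero (fun _ => 0)) by reflexivity.
  apply Series_le; [|exact Hb]. intros n. split; [lra|]. unfold b.
  apply Rmult_le_pos; [apply Rmult_le_pos; [apply pow2_ge_0|apply Rabs_pos]|].
  apply pow_le; unfold R0; lra. }
exists (Rmin 1 (eps / (2 * B + 1))). split.
{ apply Rmin_pos; [lra|apply Rdiv_lt_0_compat; lra]. }
intros y Hy.
set (h := (y - z)%C) in *.
assert (Hyz : y = (z + h)%C) by (unfold h; ring).
assert (Hh1 : Cmod h <= 1) by (apply Rlt_le; eapply Rlt_le_trans; [exact Hy|apply Rmin_l]).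
assert (Hh2 : Cmod h * (2 * B + 1) <= eps).
{ apply Rle_trans with (eps / (2 * B + 1) * (2 * B + 1)); [|right; field; lra].
  apply Rmult_le_compat_r; [lra|].
  apply Rlt_le; eapply Rlt_le_trans; [exact Hy|apply Rmin_r]. }
pose proof (Cmod_ge_0 h) as Hh0.
assert (HzR : Cmod z <= R0) by (unfold R0; lra).
assert (HyR : Cmod (z + h) <= R0).
{ eapply Rle_trans; [apply Cmod_triangle|]. unfold R0; lra. }
set (e := fun n => (RtoC (a (S n)) *
  ((z + h) ^ S n - z ^ S n - RtoC (INR (S n)) * z ^ n * h))%C).
assert (He : (CPSeries a y - CPSeries a z - h * CPSeries (PS_derive a) z)%C = CSeries e).
{ rewrite Hyz.
  assert (Hd := entire_derive a Ha).
  assert (Hshift : forall u : nat -> R, ex_series (fun n => a n * u n) ->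
    ex_series (fun n => a (S n) * u (S n))).
  { intros u Hu. apply (ex_series_incr_1 (fun n => a n * u n)). exact Hu. }
  pose proof (ex_series_Re a (z + h)%C Ha) as E1. pose proof (ex_series_Re a z Ha) as E2.
  pose proof (ex_series_Re _ z Hd) as E3.
  pose proof (ex_series_Im a (z + h)%C Ha) as F1. pose proof (ex_series_Im a z Ha) as F2.
  pose proof (ex_series_Im _ z Hd) as F3.
  apply injective_projections.
  - change (Re (CPSeries a (z + h)%C) - Re (CPSeries a z)
      - (Re h * Re (CPSeries (PS_derive a) z) - Im h * Im (CPSeries (PS_derive a) z))
      = Series (fun n => Re (e n))).
    rewrite !Re_CPSeries, Im_CPSeries.
    rewrite (Series_incr_1 (fun n => a n * Re ((z + h) ^ n))) by exact E1.
    rewrite (Series_incr_1 (fun n => a n * Re (z ^ n))) by exact E2.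
    rewrite <- !Series_scal_l, <- Series_minus
      by (apply (ex_series_scal (V := R_NormedModule)); assumption).
    match goal with |- ?u + ?S1 - (?v + ?S2) - ?S3 = _ =>
      replace (u + S1 - (v + S2) - S3) with (S1 - S2 - S3) by (simpl; ring) end.
    rewrite Series_minus3.
    + apply Series_ext. intros n. unfold e, PS_derive.
      rewrite Re_RtoC_mult, !Re_minus.
      replace (RtoC (INR (S n)) * z ^ n * h)%C with (RtoC (INR (S n)) * (z ^ n * h))%C by ring.
      rewrite Re_RtoC_mult.
      replace (Re (z ^ n * h)) with (Re (z ^ n) * Re h - Im (z ^ n) * Im h) by reflexivity.
      ring.
    + apply (Hshift (fun n => Re ((z + h) ^ n))), E1.
    + apply (Hshift (fun n => Re (z ^ n))), E2.
    + apply (ex_series_minus (V := R_NormedModule));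
        apply (ex_series_scal (V := R_NormedModule)); assumption.
  - change (Im (CPSeries a (z + h)%C) - Im (CPSeries a z)
      - (Re h * Im (CPSeries (PS_derive a) z) + Im h * Re (CPSeries (PS_derive a) z))
      = Series (fun n => Im (e n))).
    rewrite !Im_CPSeries, Re_CPSeries.
    rewrite (Series_incr_1 (fun n => a n * Im ((z + h) ^ n))) by exact F1.
    rewrite (Series_incr_1 (fun n => a n * Im (z ^ n))) by exact F2.
    rewrite <- !Series_scal_l, <- Series_plus
      by (apply (ex_series_scal (V := R_NormedModule)); assumption).
    match goal with |- ?u + ?S1 - (?v + ?S2) - ?S3 = _ =>
      replace (u + S1 - (v + S2) - S3) with (S1 - S2 - S3) by (simpl; ring) end.
    rewrite Series_minus3.
    + apply Series_ext. intros n. unfold e, PS_derive.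
      rewrite Im_RtoC_mult, !Im_minus.
      replace (RtoC (INR (S n)) * z ^ n * h)%C with (RtoC (INR (S n)) * (z ^ n * h))%C by ring.
      rewrite Im_RtoC_mult.
      replace (Im (z ^ n * h)) with (Re (z ^ n) * Im h + Im (z ^ n) * Re h) by reflexivity.
      ring.
    + apply (Hshift (fun n => Im ((z + h) ^ n))), F1.
    + apply (Hshift (fun n => Im (z ^ n))), F2.
    + apply (ex_series_plus (V := R_NormedModule));
        apply (ex_series_scal (V := R_NormedModule)); assumption. }
rewrite He.
assert (Hex : ex_series (fun n => Cmod h ^ 2 * b n))
  by (apply (ex_series_scal (V := R_NormedModule)); exact Hb).
assert (Hbound : Cmod (CSeries e) <= 2 * (Cmod h ^ 2 * B)).
{ unfold B. rewrite <- Series_scal_l. apply Cmod_CSeries_le; [|exact Hex].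
  intros n. unfold e. rewrite Cmod_mult, Cmod_R.
  replace (Cmod h ^ 2 * b n)
    with (Rabs (a (S n)) * (INR n ^ 2 * R0 ^ n * Cmod h ^ 2)) by (unfold b; ring).
  apply Rmult_le_compat_l; [apply Rabs_pos|].
  apply pow_remainder_bound; auto. unfold R0; lra. }
nra.
Qed.

Lemma C_derive_CPSeries (a : nat -> R) :
  entire a -> C_derive (CPSeries a) = CPSeries (PS_derive a).
Proof.
intros Ha. apply functional_extensionality. intros z.
apply is_C_derive_unique, is_derive_C_diff, CPSeries_C_diff, Ha.
Qed.

Lemma analytic_CPSeries (a : nat -> R) : entire a -> analytic_on_disk (CPSeries a).
Proof.
intros Ha z _. exists (CPSeries (PS_derive a) z).
apply is_derive_C_diff, CPSeries_C_diff, Ha.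
Qed.

Lemma C_derive_n_CPSeries (a : nat -> R) (k : nat) :
  entire a ->
  entire (Nat.iter k PS_derive a) /\
  C_derive_n (CPSeries a) k = CPSeries (Nat.iter k PS_derive a).
Proof.
intros Ha. unfold C_derive_n. induction k as [|k [IH1 IH2]].
- split; [exact Ha|reflexivity].
- split.
  + simpl. apply entire_derive, IH1.
  + simpl. rewrite IH2. apply C_derive_CPSeries, IH1.
Qed.

Lemma iter_PS_derive (a : nat -> R) (k m : nat) :
  Nat.iter k PS_derive a m = INR (fact (m + k)) / INR (fact m) * a (m + k)%nat.
Proof.
revert m. induction k as [|k IH]; intros m.
- rewrite Nat.add_0_r. simpl. field. apply INR_fact_neq_0.
- simpl. unfold PS_derive at 1. rewrite IH.
  replace (S m + k)%nat with (m + S k)%nat by lia.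
  rewrite (fact_simpl m), mult_INR. field.
  split; [apply INR_fact_neq_0|]. apply not_0_INR; lia.
Qed.

Lemma CPSeries_incr_1 (a : nat -> R) (z : C) :
  entire a -> CPSeries (PS_incr_1 a) z = (z * CPSeries a z)%C.
Proof.
intros Ha.
pose proof (entire_incr_1 a Ha) as Hi.
apply injective_projections.
- change (Re (CPSeries (PS_incr_1 a) z)
    = Re z * Re (CPSeries a z) - Im z * Im (CPSeries a z)).
  rewrite !Re_CPSeries, Im_CPSeries, Series_incr_1 by exact (ex_series_Re _ z Hi).
  rewrite <- !Series_scal_l, <- Series_minus
    by (apply (ex_series_scal (V := R_NormedModule)); auto using ex_series_Re, ex_series_Im).
  simpl. rewrite Rmult_0_l, Rplus_0_l. apply Series_ext. intros n.
  change (a n * (Re z * Re (z ^ n) - Im z * Im (z ^ n))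
    = Re z * (a n * Re (z ^ n)) - Im z * (a n * Im (z ^ n))). ring.
- change (Im (CPSeries (PS_incr_1 a) z)
    = Re z * Im (CPSeries a z) + Im z * Re (CPSeries a z)).
  rewrite !Im_CPSeries, Re_CPSeries, Series_incr_1 by exact (ex_series_Im _ z Hi).
  rewrite <- !Series_scal_l, <- Series_plus
    by (apply (ex_series_scal (V := R_NormedModule)); auto using ex_series_Re, ex_series_Im).
  simpl. rewrite Rmult_0_l, Rplus_0_l. apply Series_ext. intros n.
  change (a n * (Re z * Im (z ^ n) + Im z * Re (z ^ n))
    = Re z * (a n * Im (z ^ n)) + Im z * (a n * Re (z ^ n))). ring.
Qed.

(** * The Gamma function *)

Lemma ex_RInt_pos (f : R -> R) (a b : R) :
  (forall t, 0 < t -> continuous f t) -> 0 < a -> a <= b -> ex_RInt f a b.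
Proof.
intros Hc Ha Hab. apply (ex_RInt_continuous (V := R_CompleteNormedModule)).
intros t Ht. rewrite Rmin_left in Ht by exact Hab. apply Hc. lra.
Qed.

(** The improper integral of a positive function is the supremum of its proper
    integrals. *)
Lemma is_RInt_gen_pos_bounded (f : R -> R) (B : R) :
  (forall t, 0 < t -> continuous f t) ->
  (forall t, 0 < t -> 0 < f t) ->
  (forall a b, 0 < a -> a <= b -> RInt f a b <= B) ->
  exists l, 0 < l /\ is_RInt_gen f (at_right 0) (Rbar_locally p_infty) l.
Proof.
intros Hc Hpos HB.
set (E := fun x => exists a b, 0 < a /\ a <= b /\ x = RInt f a b).
destruct (completeness E) as [l [Hub Hleast]].
{ exists B. intros x (a & b & Ha & Hab & ->). auto. }
{ exists (RInt f 1 1), 1, 1. repeat split; lra. }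
exists l. split.
{ apply Rlt_le_trans with (RInt f 1 2).
  - apply RInt_gt_0; [lra| |]; intros t Ht; [apply Hpos|apply Hc]; lra.
  - apply Hub. exists 1, 2. repeat split; lra. }
assert (Hmono : forall a a0 b0 b, 0 < a -> a <= a0 -> a0 <= b0 -> b0 <= b ->
  RInt f a0 b0 <= RInt f a b).
{ intros a a0 b0 b Ha H1 H2 H3.
  assert (H0 : forall u v, 0 < u -> u <= v -> 0 <= RInt f u v).
  { intros u v Hu Huv. apply RInt_ge_0; [exact Huv|apply ex_RInt_pos; auto|].
    intros t Ht. apply Rlt_le, Hpos. lra. }
  assert (E1 : RInt f a a0 + RInt f a0 b = RInt f a b)
    by (apply (RInt_Chasles f a a0 b); apply ex_RInt_pos; auto; lra).
  assert (E2 : RInt f a0 b0 + RInt f b0 b = RInt f a0 b)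
    by (apply (RInt_Chasles f a0 b0 b); apply ex_RInt_pos; auto; lra).
  pose proof (H0 a a0 Ha H1). assert (0 <= RInt f b0 b) by (apply H0; lra). lra. }
intros P [eps HP].
assert (Hex : exists a0 b0, 0 < a0 /\ a0 <= b0 /\ l - eps < RInt f a0 b0).
{ apply NNPP; intros Hn. assert (l <= l - eps); [|pose proof (cond_pos eps); lra].
  apply Hleast. intros x (a & b & Ha & Hab & ->). apply Rnot_lt_le; intros Hlt.
  apply Hn. exists a, b. auto. }
destruct Hex as (a0 & b0 & Ha0 & Hab0 & Hlt).
unfold filtermapi.
apply Filter_prod with (fun a => 0 < a /\ a < a0) (fun b => b0 < b).
- exists (mkposreal a0 Ha0). intros y Hy Hy0. split; [exact Hy0|].
  unfold ball in Hy; simpl in Hy; unfold AbsRing_ball, abs, minus, plus, opp in Hy; simpl in Hy.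
  apply Rabs_def2 in Hy. lra.
- exists b0. auto.
- intros a b [Ha1 Ha2] Hb. exists (RInt f a b). split.
  + apply (RInt_correct (V := R_CompleteNormedModule)), ex_RInt_pos; simpl; auto; lra.
  + apply HP. unfold ball; simpl; unfold AbsRing_ball, abs, minus, plus, opp; simpl.
    assert (RInt f a b <= l) by (apply Hub; exists a, b; repeat split; lra).
    assert (RInt f a0 b0 <= RInt f a b) by (apply Hmono; lra).
    pose proof (cond_pos eps). apply Rabs_def1; lra.
Qed.

Definition gamma_integrand (x t : R) : R := Rpower t (x - 1) * exp (- t).

Lemma is_derive_Rpower_base (x t : R) :
  0 < t -> is_derive (fun t => Rpower t x) t (x * Rpower t (x - 1)).
Proof.
intros Ht. unfold Rpower. auto_derive; [exact Ht|].
replace ((x - 1) * ln t) with (x * ln t + - ln t) by ring.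
rewrite exp_plus, exp_Ropp, exp_ln by exact Ht. field. lra.
Qed.

Lemma Rpower_pos (t x : R) : 0 < Rpower t x.
Proof. apply exp_pos. Qed.

Lemma continuous_gamma_integrand (x t : R) : 0 < t -> continuous (gamma_integrand x) t.
Proof.
intros Ht. apply (ex_derive_continuous (V := R_NormedModule)).
unfold gamma_integrand, Rpower. auto_derive. exact Ht.
Qed.

(** From [ln t <= t / (2 x) + ln (2 x)]. *)
Lemma Rpower_le_exp_half (x t : R) :
  0 < x -> 0 < t -> Rpower t x <= exp (x * ln (2 * x)) * exp (t / 2).
Proof.
intros Hx Ht. unfold Rpower. rewrite <- exp_plus.
assert (Hln : ln t <= t / (2 * x) + ln (2 * x)).
{ replace t with (t / (2 * x) * (2 * x)) at 1 by (field; lra).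
  assert (Hq : 0 < t / (2 * x)) by (apply Rdiv_lt_0_compat; lra).
  rewrite ln_mult by lra.
  pose proof (exp_ineq1_le (ln (t / (2 * x)))) as He. rewrite exp_ln in He by exact Hq. lra. }
assert (Hle : x * ln t <= x * ln (2 * x) + t / 2).
{ apply Rle_trans with (x * (t / (2 * x) + ln (2 * x))).
  - apply Rmult_le_compat_l; lra.
  - right. field. lra. }
destruct Hle as [Hle|Hle]; [left; now apply exp_increasing|right; now rewrite Hle].
Qed.

(** The integrand is at most a constant times the derivative of the bounded
    function [t^x / (1 + t^x)]. *)
Lemma RInt_gamma_integrand_le (x a b : R) :
  0 < x -> 0 < a -> a <= b ->
  RInt (gamma_integrand x) a b <= (1 + exp (x * ln (2 * x))) ^ 2 / x.
Proof.
intros Hx Ha Hab.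
set (D := exp (x * ln (2 * x))). set (K := (1 + D) ^ 2 / x).
assert (HD : 0 < D) by apply exp_pos.
assert (HK : 0 < K) by (apply Rdiv_lt_0_compat; [apply pow_lt; lra|exact Hx]).
set (G := fun t => Rpower t x / (1 + Rpower t x)).
set (g := fun t => x * Rpower t (x - 1) / (1 + Rpower t x) ^ 2).
assert (HG : is_RInt g a b (G b - G a)).
{ apply (is_RInt_derive (V := R_CompleteNormedModule) G g).
  - intros t Ht. rewrite Rmin_left in Ht by exact Hab.
    pose proof (Rpower_pos t x) as Hp.
    assert (Hder := is_derive_Rpower_base x t ltac:(lra)).
    unfold G, g.
    replace (x * Rpower t (x - 1) / (1 + Rpower t x) ^ 2)
      with ((x * Rpower t (x - 1) * (1 + Rpower t x)
             - Rpower t x * (x * Rpower t (x - 1))) / (1 + Rpower t x) ^ 2)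
      by (field; lra).
    apply (is_derive_div (fun t => Rpower t x) (fun t => 1 + Rpower t x)); [exact Hder| |lra].
    replace (x * Rpower t (x - 1)) with (0 + x * Rpower t (x - 1)) by ring.
    apply (is_derive_plus (V := R_NormedModule) (fun _ => 1)); [apply @is_derive_const|exact Hder].
  - intros t Ht. rewrite Rmin_left in Ht by exact Hab.
    apply (ex_derive_continuous (V := R_NormedModule)).
    pose proof (Rpower_pos t x) as Hp.
    unfold g, Rpower in *. auto_derive. repeat split; try lra.
    apply Rgt_not_eq. simpl. nra. }
assert (Hle : RInt (gamma_integrand x) a b <= K * (G b - G a)).
{ apply (is_RInt_le (gamma_integrand x) (fun t => K * g t) a b _ _ Hab).
  - apply (RInt_correct (V := R_CompleteNormedModule)), ex_RInt_pos; auto.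
    intros t Ht; apply continuous_gamma_integrand, Ht.
  - exact (is_RInt_scal (V := R_NormedModule) g a b K _ HG).
  - intros t Ht. unfold gamma_integrand, K, g.
    pose proof (Rpower_pos t x) as Hp. pose proof (Rpower_pos t (x - 1)) as Hp1.
    assert (Hb := Rpower_le_exp_half x t Hx ltac:(lra)). fold D in Hb.
    set (y := exp (t / 2)) in *.
    assert (Hy : 1 <= y).
    { unfold y. pose proof (exp_ineq1_le (t / 2)). lra. }
    assert (Hexp : exp (- t) = / y ^ 2).
    { rewrite exp_Ropp. f_equal. unfold y. simpl. rewrite Rmult_1_r, <- exp_plus.
      f_equal. lra. }
    rewrite Hexp.
    replace ((1 + D) ^ 2 / x * (x * Rpower t (x - 1) / (1 + Rpower t x) ^ 2))
      with (Rpower t (x - 1) * ((1 + D) ^ 2 / (1 + Rpower t x) ^ 2)) by (field; lra).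
    apply Rmult_le_compat_l; [lra|].
    apply Rmult_le_reg_r with (y ^ 2 * (1 + Rpower t x) ^ 2).
    { apply Rmult_lt_0_compat; apply pow_lt; lra. }
    replace (/ y ^ 2 * (y ^ 2 * (1 + Rpower t x) ^ 2)) with ((1 + Rpower t x) ^ 2)
      by (field; lra).
    replace ((1 + D) ^ 2 / (1 + Rpower t x) ^ 2 * (y ^ 2 * (1 + Rpower t x) ^ 2))
      with (((1 + D) * y) ^ 2) by (field; lra).
    apply pow_incr. nra. }
eapply Rle_trans; [exact Hle|].
assert (HG1 : forall t, 0 < G t < 1).
{ intros t. unfold G. pose proof (Rpower_pos t x). split.
  - apply Rdiv_lt_0_compat; lra.
  - apply Rmult_lt_reg_r with (1 + Rpower t x); [lra|].
    replace (Rpower t x / (1 + Rpower t x) * (1 + Rpower t x)) with (Rpower t x) by (field; lra).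
    lra. }
pose proof (HG1 a). pose proof (HG1 b). nra.
Qed.

Lemma Gamma_correct (x : R) :
  0 < x ->
  0 < Gamma x /\
  is_RInt_gen (gamma_integrand x) (at_right 0) (Rbar_locally p_infty) (Gamma x).
Proof.
intros Hx.
destruct (is_RInt_gen_pos_bounded (gamma_integrand x) _
  (fun t Ht => continuous_gamma_integrand x t Ht)
  (fun t Ht => Rmult_lt_0_compat _ _ (Rpower_pos t (x - 1)) (exp_pos (- t)))
  (fun a b Ha Hab => RInt_gamma_integrand_le x a b Hx Ha Hab)) as [l [Hl Hint]].
assert (HG : Gamma x = l) by (exact (is_RInt_gen_unique (gamma_integrand x) l Hint)).
rewrite HG. split; assumption.
Qed.

Lemma Gamma_pos (x : R) : 0 < x -> 0 < Gamma x.
Proof. intros Hx. apply Gamma_correct, Hx. Qed.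

(** Integration by parts with the primitive [- t^x exp (- t)], which vanishes at
    both ends. *)
Lemma Gamma_succ (x : R) : 0 < x -> Gamma (x + 1) = x * Gamma x.
Proof.
intros Hx.
destruct (Gamma_correct x Hx) as [_ Hint].
set (F := fun t => - (Rpower t x * exp (- t))).
set (dF := fun t => Rpower t x * exp (- t) - x * gamma_integrand x t).
assert (HF : forall t, 0 < t -> is_derive F t (dF t)).
{ intros t Ht. unfold F, dF, gamma_integrand.
  assert (Hd := is_derive_Rpower_base x t Ht).
  assert (He : is_derive (fun t => exp (- t)) t (- exp (- t))) by (auto_derive; [auto|ring]).
  replace (Rpower t x * exp (- t) - x * (Rpower t (x - 1) * exp (- t)))
    with (- (x * Rpower t (x - 1) * exp (- t) + Rpower t x * - exp (- t))) by ring.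
  apply (is_derive_opp (V := R_NormedModule) (fun t => Rpower t x * exp (- t))).
  apply (is_derive_mult (fun t => Rpower t x) (fun t => exp (- t)) t); auto.
  intros; apply Rmult_comm. }
assert (HdF : forall t, 0 < t -> continuous dF t).
{ intros t Ht. apply (ex_derive_continuous (V := R_NormedModule)).
  unfold dF, gamma_integrand, Rpower. auto_derive. auto. }
assert (Hball : forall e u, Rabs (u - 0) < e -> ball 0 e u) by (intros e u Hu; exact Hu).
assert (Hpos2 : filter_prod (at_right 0) (Rbar_locally p_infty)
  (fun ab => forall t, Rmin (fst ab) (snd ab) <= t <= Rmax (fst ab) (snd ab) -> 0 < t)).
{ apply Filter_prod with (fun a => 0 < a) (fun b => 0 < b).
  - exists (mkposreal 1 Rlt_0_1). auto.
  - exists 0. auto.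
  - intros a b Ha Hb t Ht. simpl in Ht.
    assert (0 < Rmin a b) by (apply Rmin_pos; assumption). lra. }
assert (Hder : is_RInt_gen (Derive F) (at_right 0) (Rbar_locally p_infty) (0 - 0)).
{ apply is_RInt_gen_Derive; try apply _.
  - revert Hpos2. apply filter_imp. intros ab Hab t Ht. exists (dF t). apply HF, (Hab t Ht).
  - revert Hpos2. apply filter_imp. intros ab Hab t Ht. specialize (Hab t Ht).
    apply continuous_ext_loc with dF; [|apply HdF, Hab].
    exists (mkposreal t Hab). intros s Hs. symmetry. apply is_derive_unique, HF.
    apply Rabs_def2 in Hs. simpl in Hs. unfold minus, plus, opp in Hs. simpl in Hs. lra.
  - apply filterlim_locally. intros eps.
    exists (mkposreal (Rpower eps (/ x)) (Rpower_pos _ _)). intros t Ht Ht0.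
    apply Rabs_def2 in Ht. simpl in Ht. unfold minus, plus, opp in Ht. simpl in Ht.
    apply Hball. unfold F. rewrite Rminus_0_r, Rabs_Ropp.
    pose proof (Rpower_pos t x) as Hp. pose proof (exp_pos (- t)) as Hp2.
    rewrite Rabs_pos_eq by nra.
    assert (H1 : Rpower t x < eps).
    { pose proof (cond_pos eps) as He.
      replace (pos eps) with (Rpower (Rpower eps (/ x)) x).
      - apply Rlt_Rpower_l; lra.
      - rewrite Rpower_mult, Rinv_l, Rpower_1; lra. }
    assert (H2 : exp (- t) <= 1) by (rewrite <- exp_0; left; apply exp_increasing; lra).
    nra.
  - apply filterlim_locally. intros eps. pose proof (cond_pos eps) as He.
    set (D := exp (x * ln (2 * x))).
    assert (HD : 0 < D) by apply exp_pos.
    exists (Rmax 0 (- 2 * ln (eps / D))). intros t Ht.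
    pose proof (Rmax_l 0 (- 2 * ln (eps / D))). pose proof (Rmax_r 0 (- 2 * ln (eps / D))).
    apply Hball. unfold F. rewrite Rminus_0_r, Rabs_Ropp.
    pose proof (Rpower_pos t x) as Hp. pose proof (exp_pos (- t)) as Hp2.
    rewrite Rabs_pos_eq by nra.
    assert (Hb := Rpower_le_exp_half x t Hx ltac:(lra)). fold D in Hb.
    apply Rle_lt_trans with (D * exp (t / 2) * exp (- t)).
    { apply Rmult_le_compat_r; lra. }
    rewrite Rmult_assoc, <- exp_plus.
    replace (t / 2 + - t) with (- t / 2) by field.
    apply Rlt_le_trans with (D * exp (ln (eps / D))).
    + apply Rmult_lt_compat_l; [exact HD|]. apply exp_increasing. lra.
    + rewrite exp_ln by (apply Rdiv_lt_0_compat; lra). right. field. lra. }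
assert (Hsum := is_RInt_gen_plus _ _ _ _ Hder (is_RInt_gen_scal _ x _ Hint)).
refine (is_RInt_gen_unique (gamma_integrand (x + 1)) (x * Gamma x) _).
replace (x * Gamma x) with (plus (0 - 0) (scal x (Gamma x)))
  by (unfold plus, scal; simpl; unfold mult; simpl; ring).
revert Hsum. apply is_RInt_gen_ext; try apply _.
revert Hpos2. apply filter_imp. intros ab Hab t Ht.
assert (Ht0 : 0 < t) by (apply Hab; lra).
rewrite (is_derive_unique _ _ _ (HF t Ht0)). unfold dF, plus, scal; simpl; unfold mult; simpl.
unfold gamma_integrand. replace (x + 1 - 1) with x by ring. ring.
Qed.

(** * Bessel functions as power series *)

(** The rising factorial, or Pochhammer symbol. *)
Fixpoint poch (x : R) (n : nat) : R :=
  match n with O => 1 | S m => poch x m * (x + INR m) end.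

Lemma poch_pos (x : R) (n : nat) : 0 < x -> 0 < poch x n.
Proof.
intros Hx. induction n as [|n IH]; simpl; [lra|].
pose proof (pos_INR n). nra.
Qed.

Lemma poch_succ_l (x : R) (n : nat) : poch x (S n) = x * poch (x + 1) n.
Proof.
induction n as [|n IH]; [simpl; ring|].
change (poch x (S (S n))) with (poch x (S n) * (x + INR (S n))).
rewrite IH, S_INR. simpl. ring.
Qed.

Lemma Gamma_add_nat (x : R) (n : nat) :
  0 < x -> Gamma (x + INR n) = Gamma x * poch x n.
Proof.
intros Hx. induction n as [|n IH].
- simpl. rewrite Rplus_0_r. ring.
- rewrite S_INR. replace (x + (INR n + 1)) with (x + INR n + 1) by ring.
  pose proof (pos_INR n). rewrite Gamma_succ, IH by lra. simpl. ring.
Qed.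

(** [PSeries (bessel_coef (nu + 1))] at [y^2] is [J_nu y], up to the factor
    [(y / 2)^nu / Gamma (nu + 1)]. *)
Definition bessel_coef (mu : R) (n : nat) : R :=
  (-1) ^ n / (4 ^ n * INR (fact n) * poch mu n).

Lemma bessel_coef_0 (mu : R) : bessel_coef mu 0 = 1.
Proof. unfold bessel_coef. simpl. field. Qed.

Lemma bessel_coef_succ (mu : R) (n : nat) :
  0 < mu ->
  bessel_coef mu (S n) = - bessel_coef mu n / (4 * (INR n + 1) * (mu + INR n)).
Proof.
intros Hmu. unfold bessel_coef.
change (poch mu (S n)) with (poch mu n * (mu + INR n)).
rewrite fact_simpl, mult_INR, S_INR.
change ((-1) ^ S n) with (-1 * (-1) ^ n). change (4 ^ S n) with (4 * 4 ^ n).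
pose proof (pos_INR n). pose proof (poch_pos mu n Hmu).
pose proof (INR_fact_neq_0 n). assert (4 ^ n <> 0) by (apply pow_nonzero; lra).
field. repeat split; lra.
Qed.

Lemma bessel_coef_neq_0 (mu : R) (n : nat) : 0 < mu -> bessel_coef mu n <> 0.
Proof.
intros Hmu. unfold bessel_coef. apply Rmult_integral_contrapositive_currified.
- apply pow_nonzero; lra.
- apply Rinv_neq_0_compat. pose proof (poch_pos mu n Hmu).
  repeat apply Rmult_integral_contrapositive_currified; try lra.
  + apply pow_nonzero; lra.
  + apply INR_fact_neq_0.
Qed.

Lemma entire_bessel_coef (mu : R) : 0 < mu -> entire (bessel_coef mu).
Proof.
intros Hmu. apply CV_radius_infinite_DAlembert.
- intros n; now apply bessel_coef_neq_0.
- apply is_lim_seq_ext with (fun n => / (4 * (INR n + 1) * (mu + INR n))).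
  { intros n. pose proof (pos_INR n). pose proof (bessel_coef_neq_0 mu n Hmu).
    rewrite bessel_coef_succ by exact Hmu.
    replace (- bessel_coef mu n / (4 * (INR n + 1) * (mu + INR n)) / bessel_coef mu n)
      with (- / (4 * (INR n + 1) * (mu + INR n))) by (field; repeat split; lra).
    rewrite Rabs_Ropp, Rabs_pos_eq; [reflexivity|].
    apply Rlt_le, Rinv_0_lt_compat. nra. }
  apply is_lim_seq_le_le with (fun _ => 0) (fun n => / mu * / INR (S n)).
  + intros n. pose proof (pos_INR n). rewrite S_INR. split.
    * apply Rlt_le, Rinv_0_lt_compat. nra.
    * rewrite <- Rinv_mult. apply Rinv_le_contravar; nra.
  + apply is_lim_seq_const.
  + replace (Finite 0) with (Rbar_mult (/ mu) 0) by (simpl; f_equal; ring).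
    apply is_lim_seq_scal_l.
    apply (is_lim_seq_incr_1 (fun n => / INR n)).
    apply (is_lim_seq_inv INR p_infty); [apply is_lim_seq_INR|discriminate].
Qed.

Lemma BesselJ_PSeries (nu y : R) :
  -1 < nu -> 0 < y ->
  BesselJ nu y =
    Rpower (y / 2) nu / Gamma (nu + 1) * PSeries (bessel_coef (nu + 1)) (y ^ 2).
Proof.
intros Hnu Hy. unfold BesselJ, PSeries. rewrite <- Series_scal_l.
apply Series_ext. intros n. unfold bessel_coef.
replace (nu + INR n + 1) with (nu + 1 + INR n) by ring.
rewrite Gamma_add_nat by lra.
rewrite Rpower_plus.
replace (2 * INR n) with (INR (2 * n)) by (rewrite mult_INR; simpl; ring).
rewrite Rpower_pow by lra. rewrite pow_mult.
replace ((y / 2) ^ 2) with (y ^ 2 * / 4) by field.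
rewrite Rpow_mult_distr, pow_inv.
pose proof (Gamma_pos (nu + 1) ltac:(lra)). pose proof (poch_pos (nu + 1) n ltac:(lra)).
pose proof (INR_fact_neq_0 n). assert (4 ^ n <> 0) by (apply pow_nonzero; lra).
field. repeat split; lra.
Qed.

(** * The function q as a power series *)

Lemma q_coef_bessel_coef (nu : R) (n : nat) :
  -1 < nu -> q_coef nu n = (INR n + 1) * bessel_coef (nu + 1) n.
Proof.
intros Hnu. unfold q_coef, bessel_coef.
replace (nu + INR n + 1) with (nu + 1 + INR n) by ring.
rewrite Gamma_add_nat by lra.
pose proof (Gamma_pos (nu + 1) ltac:(lra)). pose proof (poch_pos (nu + 1) n ltac:(lra)).
pose proof (INR_fact_neq_0 n). assert (4 ^ n <> 0) by (apply pow_nonzero; lra).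
field. repeat split; lra.
Qed.

Lemma entire_q_coef (nu : R) : -1 < nu -> entire (q_coef nu).
Proof.
intros Hnu. unfold entire.
rewrite (CV_radius_ext _ (PS_derive (PS_incr_1 (bessel_coef (nu + 1))))).
- apply entire_derive, entire_incr_1, entire_bessel_coef. lra.
- intros n. rewrite q_coef_bessel_coef by exact Hnu.
  unfold PS_derive, PS_incr_1. rewrite S_INR. reflexivity.
Qed.

Lemma q_CPSeries (nu : R) : -1 < nu -> q nu = CPSeries (PS_incr_1 (q_coef nu)).
Proof.
intros Hnu. apply functional_extensionality. intros z.
assert (Hi := entire_incr_1 _ (entire_q_coef nu Hnu)).
apply injective_projections.
- change (Re (q nu z) = Re (CPSeries (PS_incr_1 (q_coef nu)) z)).
  rewrite Re_CPSeries, Series_incr_1 by exact (ex_series_Re _ z Hi).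
  simpl PS_incr_1. rewrite Rmult_0_l, Rplus_0_l.
  apply Series_ext. intros n. rewrite Re_RtoC_mult, Nat.add_1_r. reflexivity.
- change (Im (q nu z) = Im (CPSeries (PS_incr_1 (q_coef nu)) z)).
  rewrite Im_CPSeries, Series_incr_1 by exact (ex_series_Im _ z Hi).
  simpl PS_incr_1. rewrite Rmult_0_l, Rplus_0_l.
  apply Series_ext. intros n. rewrite Im_RtoC_mult, Nat.add_1_r. reflexivity.
Qed.

Lemma ex_pseries_entire (a : nat -> R) (x : R) : entire a -> ex_pseries a x.
Proof. intros Ha. apply CV_radius_inside. rewrite Ha. exact I. Qed.

Lemma is_derive_PSeries_entire (a : nat -> R) (x : R) :
  entire a -> is_derive (PSeries a) x (PSeries (PS_derive a) x).
Proof. intros Ha. apply is_derive_PSeries. rewrite Ha. exact I. Qed.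

Lemma PSeries_q_coef (nu x : R) :
  -1 < nu ->
  PSeries (q_coef nu) x = PSeries (bessel_coef (nu + 1)) x
    + x * PSeries (PS_derive (bessel_coef (nu + 1))) x.
Proof.
intros Hnu.
assert (Ht := entire_bessel_coef (nu + 1) ltac:(lra)).
rewrite <- PSeries_incr_1, <- PSeries_plus.
- apply PSeries_ext. intros n. rewrite q_coef_bessel_coef by exact Hnu.
  destruct n as [|n].
  + change ((0 + 1) * bessel_coef (nu + 1) 0 = bessel_coef (nu + 1) 0 + 0). ring.
  + change ((INR (S n) + 1) * bessel_coef (nu + 1) (S n)
      = bessel_coef (nu + 1) (S n) + INR (S n) * bessel_coef (nu + 1) (S n)). ring.
- apply ex_pseries_entire, Ht.
- apply ex_pseries_entire, entire_incr_1, entire_derive, Ht.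
Qed.

Lemma is_derive_BesselJ (nu y : R) :
  -1 < nu -> 0 < y ->
  is_derive (BesselJ nu) y
    (Rpower (y / 2) nu / Gamma (nu + 1) *
      (nu / y * PSeries (bessel_coef (nu + 1)) (y ^ 2)
       + 2 * y * PSeries (PS_derive (bessel_coef (nu + 1))) (y ^ 2))).
Proof.
intros Hnu Hy.
assert (Ht := entire_bessel_coef (nu + 1) ltac:(lra)).
pose proof (Gamma_pos (nu + 1) ltac:(lra)) as HG.
set (P := PSeries (bessel_coef (nu + 1))).
apply (is_derive_ext_loc (fun y => / Gamma (nu + 1) * (Rpower (y / 2) nu * P (y ^ 2)))).
{ exists (mkposreal y Hy). intros s Hs.
  apply Rabs_def2 in Hs. simpl in Hs. unfold minus, plus, opp in Hs. simpl in Hs.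
  rewrite BesselJ_PSeries by lra. fold P.
  match goal with |- ?u = ?v => change (@eq R u v) end. field. lra. }
assert (H1 : is_derive (fun y => Rpower (y / 2) nu) y (nu / y * Rpower (y / 2) nu)).
{ unfold Rpower. auto_derive; [lra|]. unfold Rdiv. field. lra. }
assert (H2 : is_derive (fun y => P (y ^ 2)) y
  (2 * y * PSeries (PS_derive (bessel_coef (nu + 1))) (y ^ 2))).
{ apply (is_derive_comp P (fun y => y ^ 2)).
  - apply is_derive_PSeries_entire, Ht.
  - auto_derive; [auto|ring]. }
assert (H3 := is_derive_scal _ _ (/ Gamma (nu + 1)) _ (is_derive_mult _ _ _ _ _ H1 H2 Rmult_comm)).
match goal with |- is_derive _ _ ?v =>
  replace v with (/ Gamma (nu + 1) * (nu / y * Rpower (y / 2) nu * P (y ^ 2)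
    + Rpower (y / 2) nu * (2 * y * PSeries (PS_derive (bessel_coef (nu + 1))) (y ^ 2)))) end.
- exact H3.
- fold P. field. lra.
Qed.

Lemma q_eq_q_bessel (nu x : R) :
  -1 < nu -> 0 < x < 1 -> q nu (RtoC x) = RtoC (q_bessel nu x).
Proof.
intros Hnu Hx.
rewrite q_CPSeries, CPSeries_RtoC, PSeries_incr_1, PSeries_q_coef by exact Hnu.
f_equal. unfold q_bessel.
assert (Hs : 0 < sqrt x) by (apply sqrt_lt_R0; lra).
assert (Hsx : sqrt x ^ 2 = x) by (apply pow2_sqrt; lra).
pose proof (Gamma_pos (nu + 1) ltac:(lra)) as HG.
rewrite (is_derive_unique _ _ _ (is_derive_BesselJ nu _ Hnu Hs)).
rewrite BesselJ_PSeries by lra. rewrite Hsx.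
assert (Hp : Rpower 2 (nu - 1) * Rpower x (1 - nu / 2) * Rpower (sqrt x / 2) nu = x / 2).
{ replace (sqrt x / 2) with (Rpower x (/ 2) * Rpower 2 (- (1))).
  2:{ rewrite Rpower_Ropp, Rpower_1, Rpower_sqrt by lra. reflexivity. }
  rewrite <- Rpower_mult_distr by apply Rpower_pos.
  rewrite !Rpower_mult.
  replace (Rpower 2 (nu - 1) * Rpower x (1 - nu / 2)
    * (Rpower x (/ 2 * nu) * Rpower 2 (- (1) * nu)))
    with ((Rpower 2 (nu - 1) * Rpower 2 (- (1) * nu))
      * (Rpower x (1 - nu / 2) * Rpower x (/ 2 * nu))) by ring.
  rewrite <- !Rpower_plus.
  replace (nu - 1 + - (1) * nu) with (- (1)) by ring.
  replace (1 - nu / 2 + / 2 * nu) with 1 by field.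
  rewrite Rpower_Ropp, !Rpower_1 by lra. field. }
set (P := PSeries (bessel_coef (nu + 1)) x) in *.
set (P' := PSeries (PS_derive (bessel_coef (nu + 1))) x) in *.
transitivity (2 * (Rpower 2 (nu - 1) * Rpower x (1 - nu / 2) * Rpower (sqrt x / 2) nu)
  * (P + sqrt x ^ 2 * P')).
- rewrite Hp, Hsx. field.
- field. lra.
Qed.

(** * Power series whose linear coefficient dominates *)

(** After the linear coefficient, which is negative, the coefficients decay so
    fast that [sum_(n >= 2) n^2 |a_n| <= 6/7 |a_1|]. *)
Definition linear_dominated (a : nat -> R) : Prop :=
  a 1%nat < 0 /\
  forall m, (INR m + 2) ^ 2 * Rabs (a (S (S m))) <= 3 / 4 * - a 1%nat * (1 / 8) ^ m.

Lemma is_series_geom_scal (c r : R) :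
  Rabs r < 1 -> is_series (fun n => c * r ^ n) (c / (1 - r)).
Proof.
intros Hr. exact (is_series_scal (V := R_NormedModule) c _ _ (is_series_geom r Hr)).
Qed.

Lemma Series_Rabs_geom_le (u : nat -> R) (c r : R) :
  0 <= r < 1 -> (forall n, Rabs (u n) <= c * r ^ n) ->
  ex_series u /\ Rabs (Series u) <= c / (1 - r).
Proof.
intros Hr Hu.
assert (Hg := is_series_geom_scal c r ltac:(rewrite Rabs_pos_eq; lra)).
assert (Hex : ex_series (fun n => c * r ^ n)) by (eexists; exact Hg).
split.
- apply ex_series_le_R with (2 := Hex). exact Hu.
- rewrite <- (is_series_unique _ _ Hg).
  eapply Rle_trans; [apply Series_Rabs|].
  + apply ex_series_le_R with (2 := Hex). intros n. rewrite Rabs_Rabsolu. apply Hu.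
  + apply Series_le; [|exact Hex]. intros n. split; [apply Rabs_pos|apply Hu].
Qed.

Lemma linear_dominated_Series (a u : nat -> R) (D : R) :
  linear_dominated a -> u 0%nat = 0 -> 0 <= D ->
  (forall n, Rabs (u n) <= INR n ^ 2 * D) ->
  Rabs (Series (fun n => a n * u n) - a 1%nat * u 1%nat) <= 6 / 7 * - a 1%nat * D.
Proof.
intros [Ha1 Ha] Hu0 HD Hu.
destruct (Series_Rabs_geom_le (fun m => a (S (S m)) * u (S (S m)))
  (3 / 4 * - a 1%nat * D) (1 / 8)) as [Hex Hle]; [lra| |].
{ intros m. rewrite Rabs_mult. specialize (Ha m). specialize (Hu (S (S m))).
  rewrite !S_INR in Hu. replace (INR m + 1 + 1) with (INR m + 2) in Hu by ring.
  pose proof (Rabs_pos (a (S (S m)))).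
  apply Rle_trans with (Rabs (a (S (S m))) * ((INR m + 2) ^ 2 * D)).
  - apply Rmult_le_compat_l; assumption.
  - replace (3 / 4 * - a 1%nat * D * (1 / 8) ^ m)
      with ((3 / 4 * - a 1%nat * (1 / 8) ^ m) * D) by ring.
    replace (Rabs (a (S (S m))) * ((INR m + 2) ^ 2 * D))
      with ((INR m + 2) ^ 2 * Rabs (a (S (S m))) * D) by ring.
    apply Rmult_le_compat_r; assumption. }
assert (Hex1 : ex_series (fun n => a (S n) * u (S n)))
  by (apply (ex_series_incr_1 (fun n => a (S n) * u (S n))); exact Hex).
assert (Hex0 : ex_series (fun n => a n * u n))
  by (apply (ex_series_incr_1 (fun n => a n * u n)); exact Hex1).
rewrite (Series_incr_1 _ Hex0), (Series_incr_1 _ Hex1), Hu0.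
match goal with |- Rabs ?v <= _ =>
  replace v with (Series (fun m => a (S (S m)) * u (S (S m)))) by ring end.
eapply Rle_trans; [exact Hle|]. right. field.
Qed.

(** The numbers [d_n = 1 - Re z^n] satisfy
    [|d_(n+2) - 2 d_(n+1) + d_n| = |Re (z^n (1 - z)^2)| <= |1 - z|^2 <= 2 d_1]. *)
Lemma one_minus_Re_pow_le (z : C) (n : nat) :
  Cmod z <= 1 -> 1 - Re (z ^ n) <= INR n ^ 2 * (1 - Re z).
Proof.
intros Hz.
assert (H : 1 - Re (z ^ n) <= INR n ^ 2 * (1 - Re z) /\
  Re (z ^ n) - Re (z ^ S n) <= (2 * INR n + 1) * (1 - Re z)); [|apply H].
assert (Hsq : Cmod ((1 - z) * (1 - z)) <= 2 * (1 - Re z)).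
{ rewrite Cmod_mult. replace (Cmod (1 - z) * Cmod (1 - z)) with (Cmod (1 - z) ^ 2) by ring.
  pose proof (Cmod2_alt z) as H1. rewrite Cmod2_alt.
  assert (H2 : Cmod z ^ 2 <= 1) by (rewrite <- (pow1 2); apply pow_incr; split; [apply Cmod_ge_0|exact Hz]).
  rewrite Re_minus, Im_minus. change (Re (RtoC 1)) with 1. change (Im (RtoC 1)) with 0. nra. }
induction n as [|n [IH1 IH2]].
- rewrite Cpow_1_r. simpl. change (Re (RtoC 1)) with 1. lra.
- split.
  + rewrite S_INR. nra.
  + assert (Hs : Rabs (Re (z ^ n * ((1 - z) * (1 - z)))) <= 2 * (1 - Re z)).
    { eapply Rle_trans; [apply re_le_Cmod|]. rewrite Cmod_mult, Cmod_pow.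
      assert (Cmod z ^ n <= 1) by (rewrite <- (pow1 n); apply pow_incr; split; [apply Cmod_ge_0|exact Hz]).
      assert (0 <= Cmod z ^ n) by (apply pow_le, Cmod_ge_0).
      pose proof (Cmod_ge_0 ((1 - z) * (1 - z))). nra. }
    replace (z ^ n * ((1 - z) * (1 - z)))%C
      with (z ^ n - z ^ S n - (z ^ S n - z ^ S (S n)))%C in Hs by (rewrite !Cpow_S; ring).
    rewrite !Re_minus in Hs. apply Rabs_le_between in Hs. rewrite S_INR. lra.
Qed.

(** The linear term contributes [|a_1| (1 - Re z)] to [Re f(z) - f(1)], and the
    others at most [6/7] of that. *)
Lemma linear_dominated_Re (a : nat -> R) (z : C) :
  entire a -> linear_dominated a -> unit_disk z -> PSeries a 1 < Re (CPSeries a z).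
Proof.
intros Ha Hd Hz. unfold unit_disk in Hz.
assert (Hre : Re z < 1).
{ pose proof (re_le_Cmod z) as H. apply Rabs_le_between in H. lra. }
rewrite Re_CPSeries.
assert (H1 := ex_series_entire_at_1 a Ha).
assert (H : Rabs (Series (fun n => a n * (Re (z ^ n) - 1)) - a 1%nat * (Re (z ^ 1) - 1))
  <= 6 / 7 * - a 1%nat * (1 - Re z)).
{ apply (linear_dominated_Series a (fun n => Re (z ^ n) - 1)); [exact Hd| |lra|].
  - simpl. change (Re (RtoC 1)) with 1. ring.
  - intros n. pose proof (one_minus_Re_pow_le z n ltac:(lra)).
    assert (Rabs (Re (z ^ n)) <= 1).
    { rewrite <- (pow1 n). apply Rabs_Re_pow_le. lra. }
    apply Rabs_le_between in H0. rewrite Rabs_left1 by lra. lra. }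
rewrite (Series_ext _ (fun n => a n * Re (z ^ n) - a n * 1 ^ n)) in H
  by (intros n; rewrite pow1; ring).
rewrite Series_minus in H by auto using ex_series_Re.
rewrite Cpow_1_r in H. apply Rabs_le_between in H.
unfold PSeries. destruct Hd as [Hd _]. nra.
Qed.

Lemma Rabs_Im_pow_le_mult (z : C) (n : nat) :
  Cmod z <= 1 -> Rabs (Im (z ^ n)) <= INR n * Rabs (Im z).
Proof.
intros Hz. induction n as [|n IH].
- simpl. change (Im (RtoC 1)) with 0. rewrite Rabs_R0. lra.
- change (Im (z ^ S n)) with (Re z * Im (z ^ n) + Im z * Re (z ^ n)).
  eapply Rle_trans; [apply Rabs_triang|]. rewrite !Rabs_mult, S_INR.
  pose proof (re_le_Cmod z).
  assert (Rabs (Re (z ^ n)) <= 1) by (rewrite <- (pow1 n); apply Rabs_Re_pow_le; lra).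
  pose proof (Rabs_pos (Im (z ^ n))). pose proof (Rabs_pos (Im z)).
  pose proof (Rabs_pos (Re z)). nra.
Qed.

(** Here the comparison with the linear term uses [|Im z^n| <= n |Im z|]. *)
Lemma linear_dominated_Im (a : nat -> R) (z : C) :
  linear_dominated a -> unit_disk z ->
  exists k, 0 <= k /\ Im (CPSeries a z) = - k * Im z.
Proof.
intros Hd Hz. unfold unit_disk in Hz.
assert (H : Rabs (Series (fun n => a n * Im (z ^ n)) - a 1%nat * Im (z ^ 1))
  <= 6 / 7 * - a 1%nat * Rabs (Im z)).
{ apply (linear_dominated_Series a (fun n => Im (z ^ n))); [exact Hd|reflexivity|apply Rabs_pos|].
  intros n. eapply Rle_trans; [apply Rabs_Im_pow_le_mult; lra|].
  apply Rmult_le_compat_r; [apply Rabs_pos|].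
  destruct n as [|n]; [simpl; lra|]. rewrite S_INR. pose proof (pos_INR n). nra. }
rewrite <- Im_CPSeries, Cpow_1_r in H. destruct Hd as [Hd _].
destruct (Req_dec (Im z) 0) as [H0|H0].
- exists 0. split; [lra|]. rewrite H0 in *. rewrite Rabs_R0 in H.
  apply Rabs_le_between in H. lra.
- exists (- (Im (CPSeries a z) / Im z)). split; [|field; exact H0].
  apply Rabs_le_between in H.
  assert (Hq : Im (CPSeries a z) = Im (CPSeries a z) / Im z * Im z) by (field; exact H0).
  set (k := Im (CPSeries a z) / Im z) in *. rewrite Hq in H.
  destruct (Rle_lt_dec 0 (Im z)) as [Hi|Hi].
  + rewrite Rabs_pos_eq in H by exact Hi. nra.
  + rewrite Rabs_left in H by exact Hi. nra.
Qed.

(** By comparison with a geometric series of ratio [1/3], the terms after the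
    constant one add up to at most half of it. *)
Lemma geometric_Re_pos (b : nat -> R) (z : C) :
  b 0%nat <> 0 -> (forall m, Rabs (b (S m)) <= 1 / 3 * Rabs (b m)) -> unit_disk z ->
  0 < Re (CPSeries b z / RtoC (b 0%nat)).
Proof.
intros Hb0 Hb Hz. unfold unit_disk in Hz.
assert (Hgeo : forall m, Rabs (b m) <= Rabs (b 0%nat) * (1 / 3) ^ m).
{ induction m as [|m IH]; [simpl; lra|]. specialize (Hb m).
  change ((1 / 3) ^ S m) with (1 / 3 * (1 / 3) ^ m). lra. }
assert (Hpow : forall n, Rabs (Re (z ^ n)) <= 1).
{ intros n. rewrite <- (pow1 n). apply Rabs_Re_pow_le. lra. }
destruct (Series_Rabs_geom_le (fun m => / b 0%nat * (b (S m) * Re (z ^ S m))) (1 / 3) (1 / 3))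
  as [Hex Hle]; [lra| |].
{ intros m. rewrite !Rabs_mult, Rabs_inv.
  pose proof (Rabs_pos_lt _ Hb0) as Hp. specialize (Hgeo (S m)). specialize (Hpow (S m)).
  apply Rmult_le_reg_l with (Rabs (b 0%nat)); [exact Hp|].
  rewrite <- Rmult_assoc, Rinv_r, Rmult_1_l by lra.
  change ((1 / 3) ^ S m) with (1 / 3 * (1 / 3) ^ m) in Hgeo.
  pose proof (Rabs_pos (b (S m))). nra. }
replace (CPSeries b z / RtoC (b 0%nat))%C with (RtoC (/ b 0%nat) * CPSeries b z)%C.
2:{ rewrite RtoC_inv by exact Hb0. unfold Cdiv. ring. }
rewrite Re_RtoC_mult, Re_CPSeries, <- Series_scal_l.
rewrite Series_incr_1.
- simpl (z ^ 0)%C. change (Re (RtoC 1)) with 1.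
  replace (/ b 0%nat * (b 0%nat * 1)) with 1 by (field; exact Hb0).
  apply Rabs_le_between in Hle. lra.
- apply (ex_series_incr_1 (fun n => / b 0%nat * (b n * Re (z ^ n)))). exact Hex.
Qed.

(** * Coefficient estimates *)

Lemma Rabs_bessel_coef_succ (mu : R) (n : nat) :
  0 < mu ->
  Rabs (bessel_coef mu (S n)) * (4 * (INR n + 1) * (mu + INR n)) = Rabs (bessel_coef mu n).
Proof.
intros Hmu. pose proof (pos_INR n).
rewrite <- (Rabs_pos_eq (4 * (INR n + 1) * (mu + INR n))) by nra.
rewrite <- Rabs_mult, bessel_coef_succ by exact Hmu.
rewrite <- Rabs_Ropp. f_equal. field. lra.
Qed.

(** The factor [(m + 2)^2 (m + 3)^2] serves both [q'], with coefficients
    [(n + 1)^2 t_n], and [q / z], with coefficients [(n + 1) t_n].  The bound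
    [17/20] is a round number below the critical [mu], about [0.8562]. *)
Lemma bessel_coef_decay (mu : R) (m : nat) :
  17 / 20 <= mu ->
  (INR m + 2) ^ 2 * (INR m + 3) ^ 2 * Rabs (bessel_coef mu (S (S m)))
    <= 3 * Rabs (bessel_coef mu 1) * (1 / 8) ^ m.
Proof.
intros Hmu. induction m as [|m IH].
- pose proof (Rabs_bessel_coef_succ mu 1 ltac:(lra)) as H. rewrite <- H. simpl INR. simpl pow.
  pose proof (Rabs_pos (bessel_coef mu 2)). nra.
- pose proof (Rabs_bessel_coef_succ mu (S (S m)) ltac:(lra)) as H.
  pose proof (pos_INR m) as Hm.
  rewrite !S_INR in *. change ((1 / 8) ^ S m) with (1 / 8 * (1 / 8) ^ m).
  set (x := INR m) in *. set (r := Rabs (bessel_coef mu (S (S (S m))))) in *.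
  assert (Hr : 0 <= r) by apply Rabs_pos.
  rewrite <- H in IH.
  apply Rle_trans with (1 / 8 *
    ((x + 2) ^ 2 * (x + 3) ^ 2 * (r * (4 * (x + 1 + 1 + 1) * (mu + (x + 1 + 1)))))); [|lra].
  replace ((x + 1 + 2) ^ 2 * (x + 1 + 3) ^ 2 * r)
    with (r * (x + 3) ^ 2 * (x + 4) ^ 2) by ring.
  replace (1 / 8 * ((x + 2) ^ 2 * (x + 3) ^ 2 * (r * (4 * (x + 1 + 1 + 1) * (mu + (x + 1 + 1))))))
    with (r * (x + 3) ^ 2 * ((x + 2) ^ 2 * (x + 3) * (mu + (x + 2)) / 2)) by field.
  apply Rmult_le_compat_l; [apply Rmult_le_pos; [exact Hr|apply pow2_ge_0]|].
  assert (Hq : 0 <= (x + 2) ^ 2 * (x + 3)) by (apply Rmult_le_pos; [apply pow2_ge_0|lra]).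
  assert ((x + 2) ^ 2 * (x + 3) * (57 / 20 + x) <= (x + 2) ^ 2 * (x + 3) * (mu + (x + 2)))
    by (apply Rmult_le_compat_l; lra).
  assert (2 * (x + 4) ^ 2 <= (x + 2) ^ 2 * (x + 3) * (57 / 20 + x)).
  { assert (0 <= x * x) by nra. assert (0 <= x * x * x) by nra.
    assert (0 <= x * x * x * x) by nra. lra. }
  lra.
Qed.

Lemma bessel_coef_1_neg (mu : R) : 0 < mu -> bessel_coef mu 1 < 0.
Proof.
intros Hmu. rewrite bessel_coef_succ, bessel_coef_0 by exact Hmu. simpl.
assert (0 < 1 / (4 * (0 + 1) * (mu + 0))) by (apply Rdiv_lt_0_compat; lra). lra.
Qed.

Lemma linear_dominated_q_coef (nu : R) :
  -3 / 20 <= nu -> linear_dominated (q_coef nu).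
Proof.
intros Hnu. pose proof (bessel_coef_1_neg (nu + 1) ltac:(lra)) as H1.
split.
- rewrite q_coef_bessel_coef by lra. simpl INR. lra.
- intros m. rewrite !q_coef_bessel_coef by lra.
  pose proof (bessel_coef_decay (nu + 1) m ltac:(lra)) as H.
  rewrite (Rabs_left (bessel_coef (nu + 1) 1)) in H by exact H1.
  pose proof (pos_INR m) as Hm. rewrite !S_INR in *. simpl INR.
  rewrite Rabs_mult, Rabs_pos_eq by lra.
  set (r := Rabs (bessel_coef (nu + 1) (S (S m)))) in *.
  assert (Hr : 0 <= r) by apply Rabs_pos.
  set (x := INR m) in *. assert (0 <= (x + 2) ^ 2 * r) by (apply Rmult_le_pos; [apply pow2_ge_0|exact Hr]).
  assert (0 <= - bessel_coef (nu + 1) 1 * (1 / 8) ^ m) by (apply Rmult_le_pos; [lra|apply pow_le; lra]).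
  assert (3 * ((x + 2) ^ 2 * r * (x + 3)) <= (x + 2) ^ 2 * (x + 3) ^ 2 * r).
  { replace ((x + 2) ^ 2 * (x + 3) ^ 2 * r) with ((x + 3) * ((x + 2) ^ 2 * r * (x + 3))) by ring.
    apply Rmult_le_compat_r; [|lra]. apply Rmult_le_pos; lra. }
  lra.
Qed.

Lemma PS_derive_incr_1 (a : nat -> R) (n : nat) :
  PS_derive (PS_incr_1 a) n = (INR n + 1) * a n.
Proof. unfold PS_derive, PS_incr_1. now rewrite S_INR. Qed.

Lemma linear_dominated_q_derive (nu : R) :
  -3 / 20 <= nu -> linear_dominated (PS_derive (PS_incr_1 (q_coef nu))).
Proof.
intros Hnu. pose proof (bessel_coef_1_neg (nu + 1) ltac:(lra)) as H1.
split.
- rewrite PS_derive_incr_1, q_coef_bessel_coef by lra. simpl INR. lra.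
- intros m. rewrite !PS_derive_incr_1, !q_coef_bessel_coef by lra.
  pose proof (bessel_coef_decay (nu + 1) m ltac:(lra)) as H.
  rewrite (Rabs_left (bessel_coef (nu + 1) 1)) in H by exact H1.
  pose proof (pos_INR m) as Hm. rewrite !S_INR in *. simpl INR.
  rewrite !Rabs_mult, !Rabs_pos_eq by lra.
  set (r := Rabs (bessel_coef (nu + 1) (S (S m)))) in *. lra.
Qed.

Lemma q_derivatives_coef_decay (nu : R) (k m : nat) :
  -3 / 20 <= nu -> (1 <= k)%nat ->
  Rabs (Nat.iter (S k) PS_derive (PS_incr_1 (q_coef nu)) (S m))
    <= 1 / 3 * Rabs (Nat.iter (S k) PS_derive (PS_incr_1 (q_coef nu)) m).
Proof.
intros Hnu Hk. rewrite !iter_PS_derive.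
replace (S m + S k)%nat with (S (S (m + k))) by lia.
replace (m + S k)%nat with (S (m + k)) by lia.
unfold PS_incr_1. rewrite !q_coef_bessel_coef by lra.
pose proof (Rabs_bessel_coef_succ (nu + 1) (m + k) ltac:(lra)) as H.
assert (HN : 1 <= INR (m + k)) by (apply (le_INR 1); lia).
pose proof (pos_INR m) as Hm.
rewrite (fact_simpl (S (m + k))), (fact_simpl m), !mult_INR, !S_INR.
pose proof (INR_fact_lt_0 (S (m + k))) as Hf. pose proof (INR_fact_lt_0 m) as Hfm.
set (A := INR (fact (S (m + k)))) in *. set (B := INR (fact m)) in *.
set (N := INR (m + k)) in *. set (x := INR m) in *.
rewrite !Rabs_mult, <- H.
set (r := Rabs (bessel_coef (nu + 1) (S (m + k)))) in *.
assert (Hr : 0 <= r) by apply Rabs_pos.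
assert (HAB : 0 < A / B) by (apply Rdiv_lt_0_compat; assumption).
replace ((N + 1 + 1) * A / ((x + 1) * B)) with ((N + 2) / (x + 1) * (A / B)) by (field; lra).
assert (Hq : 0 < (N + 2) / (x + 1)) by (apply Rdiv_lt_0_compat; lra).
rewrite (Rabs_pos_eq ((N + 2) / (x + 1) * (A / B))) by nra.
rewrite (Rabs_pos_eq (A / B)), (Rabs_pos_eq (N + 1 + 1)), (Rabs_pos_eq (N + 1)) by lra.
replace ((N + 2) / (x + 1) * (A / B) * ((N + 1 + 1) * r))
  with (A / B * r * ((N + 2) ^ 2 / (x + 1))) by (field; lra).
replace (1 / 3 * (A / B * ((N + 1) * (r * (4 * (N + 1) * (nu + 1 + N))))))
  with (A / B * r * (4 / 3 * (N + 1) ^ 2 * (nu + 1 + N))) by (field; lra).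
apply Rmult_le_compat_l; [nra|].
apply Rle_trans with ((N + 2) ^ 2).
- apply Rmult_le_reg_r with (x + 1); [lra|].
  replace ((N + 2) ^ 2 / (x + 1) * (x + 1)) with ((N + 2) ^ 2) by (field; lra). nra.
- assert (0 <= (N + 1) ^ 2 * (nu + 1 + N - (17 / 20 + N)))
    by (apply Rmult_le_pos; [apply pow2_ge_0|lra]).
  assert (0 <= (N - 1) * (N - 1)) by nra.
  assert (0 <= (N - 1) * (N - 1) * (N - 1)) by (apply Rmult_le_pos; lra).
  nra.
Qed.

Lemma q_derivatives_coef_0_neq_0 (nu : R) (k : nat) :
  -1 < nu -> Nat.iter (S k) PS_derive (PS_incr_1 (q_coef nu)) 0%nat <> 0.
Proof.
intros Hnu. rewrite iter_PS_derive. simpl (0 + S k)%nat. unfold PS_incr_1.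
rewrite q_coef_bessel_coef by exact Hnu.
pose proof (pos_INR k). pose proof (INR_fact_lt_0 (S k)).
assert (bessel_coef (nu + 1) k <> 0) by (apply bessel_coef_neq_0; lra).
apply Rmult_integral_contrapositive_currified.
- apply Rgt_not_eq, Rdiv_lt_0_compat; [assumption|apply INR_fact_lt_0].
- apply Rmult_integral_contrapositive_currified; [lra|assumption].
Qed.

(** * Sufficiency of q'(1) >= 0 *)

Lemma convex_univalent_scal (c : R) :
  c <> 0 ->
  convex_univalent (fun z => (RtoC c * z)%C) /\
  forall z, C_derive (fun z => (RtoC c * z)%C) z = RtoC c.
Proof.
intros Hc.
assert (HcC : RtoC c <> 0) by (intros H; apply Hc, RtoC_inj, H).
assert (Hd : forall z, is_derive (fun z => (RtoC c * z)%C) z (RtoC c)).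
{ intros z. apply is_derive_C_diff, C_diff_scal. }
split; [split; [split|]|].
- intros z _. exists (RtoC c). apply Hd.
- intros z1 z2 _ _ H.
  replace z1 with (RtoC c * z1 / RtoC c)%C by (field; exact HcC).
  rewrite H. field. exact HcC.
- intros w1 w2 t [z1 [Hz1 <-]] [z2 [Hz2 <-]] Ht.
  exists (RtoC (1 - t) * z1 + RtoC t * z2)%C. split; [|ring].
  unfold unit_disk in *. eapply Rle_lt_trans; [apply Cmod_triangle|].
  rewrite !Cmod_mult, !Cmod_R, !Rabs_pos_eq by lra.
  assert (HM : Rmax (Cmod z1) (Cmod z2) < 1) by (apply Rmax_lub_lt; assumption).
  assert ((1 - t) * Cmod z1 <= (1 - t) * Rmax (Cmod z1) (Cmod z2))
    by (apply Rmult_le_compat_l; [lra|apply Rmax_l]).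
  assert (t * Cmod z2 <= t * Rmax (Cmod z1) (Cmod z2))
    by (apply Rmult_le_compat_l; [lra|apply Rmax_r]).
  lra.
- intros z. apply is_C_derive_unique, Hd.
Qed.

Lemma q_derivatives_close_to_convex (nu : R) (k : nat) :
  -3 / 20 <= nu -> (1 <= k)%nat -> close_to_convex (C_derive_n (q nu) k).
Proof.
intros Hnu Hk. rewrite q_CPSeries by lra.
assert (He := entire_incr_1 _ (entire_q_coef nu ltac:(lra))).
destruct (C_derive_n_CPSeries _ k He) as [Hek ->].
set (b := Nat.iter (S k) PS_derive (PS_incr_1 (q_coef nu))).
assert (Hb0 : b 0%nat <> 0) by (apply q_derivatives_coef_0_neq_0; lra).
destruct (convex_univalent_scal _ Hb0) as [Hconv Hder].
split; [apply analytic_CPSeries, Hek|].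
exists (fun z => (RtoC (b 0%nat) * z)%C). split; [exact Hconv|].
intros z Hz. rewrite C_derive_CPSeries by exact Hek. rewrite Hder.
apply (geometric_Re_pos b z Hb0); [|exact Hz].
intros m. apply q_derivatives_coef_decay; assumption.
Qed.

(** With [p = q / z], both [q'] and [p] have positive real part, and their
    imaginary parts have the same sign; hence [Re (q' * conj p) > 0], which is the
    starlikeness condition [Re (z q' / q) > 0]. *)
Lemma q_starlike (nu : R) :
  -3 / 20 <= nu -> 0 <= PSeries (PS_derive (PS_incr_1 (q_coef nu))) 1 ->
  starlike (q nu).
Proof.
intros Hnu Hq1.
assert (Ha := entire_q_coef nu ltac:(lra)).
assert (Hi := entire_incr_1 _ Ha). assert (Hd := entire_derive _ Hi).
rewrite q_CPSeries by lra.
set (f := CPSeries (PS_incr_1 (q_coef nu))).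
set (f' := CPSeries (PS_derive (PS_incr_1 (q_coef nu)))).
set (p := CPSeries (q_coef nu)).
assert (Hre' : forall z, unit_disk z -> 0 < Re (f' z)).
{ intros z Hz. eapply Rle_lt_trans; [exact Hq1|].
  apply linear_dominated_Re; auto using linear_dominated_q_derive. }
(* [p 1 = q' 1 - p' 1], and [p' 1 < 0] since the linear coefficient dominates *)
assert (Hp1 : 0 <= PSeries (q_coef nu) 1).
{ assert (Heq : PSeries (PS_derive (PS_incr_1 (q_coef nu))) 1
    = PSeries (q_coef nu) 1 + Series (fun n => q_coef nu n * INR n)).
  { unfold PSeries. rewrite <- Series_plus.
    - apply Series_ext. intros n. rewrite PS_derive_incr_1, pow1. ring.
    - apply ex_series_entire_at_1, Ha.
    - apply (ex_series_entire_mult _ INR 4 Ha); [lra|].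
      intros n. rewrite Rabs_pos_eq by apply pos_INR.
      eapply Rle_trans; [|apply INR_sqr_le_pow4].
      destruct n as [|n]; [simpl; lra|]. rewrite S_INR. pose proof (pos_INR n). nra. }
  pose proof (linear_dominated_q_coef nu Hnu) as Hdom.
  assert (H : Rabs (Series (fun n => q_coef nu n * INR n) - q_coef nu 1%nat * INR 1)
    <= 6 / 7 * - q_coef nu 1%nat * 1).
  { apply (linear_dominated_Series (q_coef nu) INR); [exact Hdom|reflexivity|lra|].
    intros n. rewrite Rabs_pos_eq by apply pos_INR.
    destruct n as [|n]; [simpl; lra|]. rewrite S_INR. pose proof (pos_INR n). nra. }
  apply Rabs_le_between in H. simpl INR in H. destruct Hdom as [Hdom _]. lra. }
assert (Hrep : forall z, unit_disk z -> 0 < Re (p z)).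
{ intros z Hz. eapply Rle_lt_trans; [exact Hp1|].
  apply linear_dominated_Re; auto using linear_dominated_q_coef. }
assert (Hf : forall z, unit_disk z -> C_diff f z (f' z) /\ f' z <> 0).
{ intros z Hz. split; [apply CPSeries_C_diff, Hi|].
  intros H0. specialize (Hre' z Hz). rewrite H0 in Hre'. simpl in Hre'. lra. }
assert (Hfp : forall z, f z = (z * p z)%C) by (intros z; apply CPSeries_incr_1, Ha).
split; [split|].
- apply analytic_CPSeries, Hi.
- destruct (convex_univalent_scal 1 ltac:(lra)) as [[[_ Hinj] Hconv] _].
  apply (noshiro_warschawski f (fun z => (RtoC 1 * z)%C) f' (fun _ => RtoC 1)); auto.
  + intros z Hz. apply Hf, Hz.
  + intros z _. apply C_diff_scal.
  + intros z Hz. replace (f' z / RtoC 1)%C with (f' z) by field. auto.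
- apply (starlike_image f f' Hf).
  + rewrite Hfp. ring.
  + intros z Hz Hz0. rewrite Hfp.
    replace (Re (z * p z * Cconj (z * f' z)))
      with (Cmod z ^ 2 * (Re (p z) * Re (f' z) + Im (p z) * Im (f' z))).
    2:{ rewrite Cmod2_alt. unfold Cconj, Cmult, Re, Im. simpl. ring. }
    apply Rmult_lt_0_compat; [apply pow_lt, Cmod_gt_0, Hz0|].
    destruct (linear_dominated_Im _ z (linear_dominated_q_coef nu Hnu) Hz) as [k1 [Hk1 E1]].
    destruct (linear_dominated_Im _ z (linear_dominated_q_derive nu Hnu) Hz) as [k2 [Hk2 E2]].
    unfold p, f' in *. rewrite E1, E2.
    specialize (Hrep z Hz). specialize (Hre' z Hz).
    assert (0 <= k1 * k2 * (Im z * Im z)) by (apply Rmult_le_pos; nra). nra.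
Qed.

(** * Necessity of q'(1) >= 0 *)

Lemma injective_no_peak (Q : R -> R) (a m b : R) :
  continuity Q -> a < m < b -> Q a < Q m -> Q b < Q m ->
  (forall x y, a <= x <= b -> a <= y <= b -> Q x = Q y -> x = y) -> False.
Proof.
intros Hc Hamb Ha Hb Hinj.
destruct (Rle_lt_dec (Q a) (Q b)) as [H|H].
- destruct (IVT_gen Q a m (Q b) Hc) as [x [Hx HQ]].
  { rewrite Rmin_left, Rmax_right by lra. lra. }
  rewrite Rmin_left, Rmax_right in Hx by lra.
  assert (x = b) by (apply Hinj; lra). lra.
- destruct (IVT_gen Q m b (Q a) Hc) as [x [Hx HQ]].
  { rewrite Rmin_right, Rmax_left by lra. lra. }
  rewrite Rmin_left, Rmax_right in Hx by lra.
  assert (x = a) by (apply Hinj; lra). lra.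
Qed.

(** A function that is increasing at [0] and decreasing just before [1] takes
    some value twice on [[0,1)]. *)
Lemma injective_derivative_at_1_nonneg (a : nat -> R) :
  entire a -> 0 < PSeries (PS_derive a) 0 ->
  (forall x y, 0 <= x < 1 -> 0 <= y < 1 -> PSeries a x = PSeries a y -> x = y) ->
  0 <= PSeries (PS_derive a) 1.
Proof.
intros Ha H0 Hinj. apply Rnot_lt_le; intros H1.
assert (Hc : forall b, entire b -> continuity (PSeries b)).
{ intros b Hb x. apply PSeries_continuity. rewrite Hb. exact I. }
assert (Hnear : forall x, exists d, 0 < d /\ forall y, Rabs (y - x) < d ->
  Rabs (PSeries (PS_derive a) y - PSeries (PS_derive a) x) < Rabs (PSeries (PS_derive a) x) \/
  PSeries (PS_derive a) x = 0).
{ intros x. destruct (Req_dec (PSeries (PS_derive a) x) 0) as [Hx|Hx].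
  - exists 1. split; [lra|auto].
  - destruct (Hc _ (entire_derive _ Ha) x (Rabs (PSeries (PS_derive a) x))) as [d [Hd Hdd]].
    { apply Rabs_pos_lt, Hx. }
    exists d. split; [exact Hd|]. intros y Hy. left.
    destruct (Req_dec y x) as [->|Hne].
    + unfold Rminus. rewrite Rplus_opp_r, Rabs_R0. apply Rabs_pos_lt, Hx.
    + apply (Hdd y). split; [split; [exact I|auto]|exact Hy]. }
assert (Hmvt : forall x y, x < y -> exists c, x < c < y /\
  PSeries a y - PSeries a x = PSeries (PS_derive a) c * (y - x)).
{ intros x y Hxy.
  destruct (MVT_cor2 (PSeries a) (PSeries (PS_derive a)) x y Hxy) as [c [Hc1 Hc2]].
  - intros c _. apply is_derive_Reals, is_derive_PSeries_entire, Ha.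
  - exists c. split; [exact Hc2|exact Hc1]. }
destruct (Hnear 0) as [d0 [Hd0 Hn0]]. destruct (Hnear 1) as [d1 [Hd1 Hn1]].
rewrite Rabs_pos_eq in Hn0 by lra. rewrite Rabs_left in Hn1 by exact H1.
set (x1 := Rmax (1 / 2) (1 - d1 / 2)).
assert (Hx1 : 1 / 2 <= x1) by apply Rmax_l.
assert (Hx1' : 1 - d1 / 2 <= x1) by apply Rmax_r.
assert (Hx1'' : x1 < 1) by (apply Rmax_lub_lt; lra).
set (x2 := (x1 + 1) / 2). assert (Hx2 : x1 < x2 < 1) by (unfold x2; lra).
set (e := Rmin (1 / 4) (d0 / 2)).
assert (He : 0 < e) by (apply Rmin_pos; lra).
assert (He1 : e <= 1 / 4) by apply Rmin_l.
assert (He2 : e <= d0 / 2) by apply Rmin_r.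
assert (Hup : PSeries a 0 < PSeries a e).
{ destruct (Hmvt 0 e He) as [c [Hc1 Hc2]].
  destruct (Hn0 c) as [H|H]; [apply Rabs_def1; lra| |lra].
  apply Rabs_def2 in H. nra. }
assert (Hdown : PSeries a x2 < PSeries a x1).
{ destruct (Hmvt x1 x2) as [c [Hc1 Hc2]]; [lra|].
  destruct (Hn1 c) as [H|H]; [apply Rabs_def1; lra| |lra].
  apply Rabs_def2 in H. nra. }
destruct (Rlt_le_dec (PSeries a 0) (PSeries a x1)) as [H|H].
- apply (injective_no_peak (PSeries a) 0 x1 x2); auto; [lra|].
  intros x y Hx Hy. apply Hinj; lra.
- apply (injective_no_peak (PSeries a) 0 e x1); auto; try lra.
  intros x y Hx Hy. apply Hinj; lra.
Qed.

Lemma q_univalent_derivative_at_1 (nu : R) :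
  -1 < nu -> univalent (q nu) -> 0 <= PSeries (PS_derive (PS_incr_1 (q_coef nu))) 1.
Proof.
intros Hnu [_ Hinj]. rewrite q_CPSeries in Hinj by exact Hnu.
apply injective_derivative_at_1_nonneg.
- apply entire_incr_1, entire_q_coef, Hnu.
- rewrite PSeries_0, PS_derive_incr_1, q_coef_bessel_coef, bessel_coef_0 by exact Hnu.
  simpl. lra.
- intros x y Hx Hy Hxy. apply RtoC_inj. apply Hinj.
  + unfold unit_disk. rewrite Cmod_R, Rabs_pos_eq; lra.
  + unfold unit_disk. rewrite Cmod_R, Rabs_pos_eq; lra.
  + rewrite !CPSeries_RtoC, Hxy. reflexivity.
Qed.

(** * The equation for the critical order *)

(** Both Bessel series combine into [4 q'(1)] because
    [4 n t_n(mu) = - t_(n-1)(mu + 1) / mu] and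
    [4 n (n - 1) t_n(mu) = t_(n-1)(mu + 1) - t_(n-1)(mu)], where
    [t_n(mu) = bessel_coef mu n]. *)
Lemma bessel_equation_q_derivative (nu : R) :
  -1 < nu ->
  3 * BesselJ nu 1 + 2 * (nu - 2) * BesselJ (nu + 1) 1
  = 4 * (Rpower (1 / 2) nu / Gamma (nu + 1))
    * PSeries (PS_derive (PS_incr_1 (q_coef nu))) 1.
Proof.
intros Hnu. rewrite !BesselJ_PSeries by lra. rewrite pow1.
set (mu := nu + 1). assert (Hmu : 0 < mu) by (unfold mu; lra).
pose proof (Gamma_pos mu Hmu) as HG.
rewrite (Gamma_succ mu Hmu).
replace (Rpower (1 / 2) mu) with (Rpower (1 / 2) nu * / 2).
2:{ unfold mu. rewrite Rpower_plus, Rpower_1 by lra. field. }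
assert (Ht := entire_bessel_coef mu Hmu).
assert (Ht' := entire_bessel_coef (mu + 1) ltac:(lra)).
assert (Hex : forall a, entire a -> ex_series a).
{ intros a Ha. apply ex_series_ext with (fun n => a n * 1 ^ n).
  - intros n. rewrite pow1. apply Rmult_1_r.
  - apply ex_series_entire_at_1, Ha. }
assert (HP : forall a, PSeries a 1 = Series a).
{ intros a. apply Series_ext. intros n. rewrite pow1. ring. }
rewrite !HP.
set (P := Series (bessel_coef mu)). set (P' := Series (bessel_coef (mu + 1))).
set (U := fun n => 4 * INR n * (INR n + 2) * bessel_coef mu n).
assert (HU : forall n, U (S n) = - bessel_coef mu n + (1 - 3 / mu) * bessel_coef (mu + 1) n).
{ intros n. unfold U. rewrite bessel_coef_succ by exact Hmu.
  assert (Hsh : bessel_coef (mu + 1) n = mu / (mu + INR n) * bessel_coef mu n).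
  { unfold bessel_coef.
    pose proof (poch_succ_l mu n) as Hp. simpl in Hp.
    pose proof (poch_pos mu n Hmu). pose proof (poch_pos (mu + 1) n ltac:(lra)).
    pose proof (pos_INR n). pose proof (INR_fact_neq_0 n).
    assert (4 ^ n <> 0) by (apply pow_nonzero; lra).
    replace (poch mu n) with (mu * poch (mu + 1) n / (mu + INR n))
      by (rewrite <- Hp; field; lra).
    field. repeat split; lra. }
  rewrite Hsh, S_INR. pose proof (pos_INR n). field. lra. }
assert (HexU1 : ex_series (fun n => U (S n))).
{ apply ex_series_ext
    with (fun n => plus (opp (bessel_coef mu n)) (scal (1 - 3 / mu) (bessel_coef (mu + 1) n))).
  - intros n. symmetry. apply HU.
  - apply (ex_series_plus (V := R_NormedModule)).
    + apply (ex_series_opp (V := R_NormedModule)), Hex, Ht.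
    + apply (ex_series_scal (V := R_NormedModule)), Hex, Ht'. }
assert (HexU : ex_series U) by (apply ex_series_incr_1; exact HexU1).
assert (HSU : Series U = - P + (1 - 3 / mu) * P').
{ rewrite (Series_incr_1 U HexU). rewrite (Series_ext _ _ HU).
  unfold P, P'. rewrite Series_plus, Series_opp, Series_scal_l.
  - unfold U. simpl INR. ring.
  - apply (ex_series_opp (V := R_NormedModule)), Hex, Ht.
  - apply (ex_series_scal (V := R_NormedModule)), Hex, Ht'. }
assert (Hq : 4 * Series (PS_derive (PS_incr_1 (q_coef nu))) = Series U + 4 * P).
{ unfold P. rewrite <- !Series_scal_l, <- Series_plus.
  - apply Series_ext. intros n. unfold U.
    rewrite PS_derive_incr_1, q_coef_bessel_coef by exact Hnu. fold mu. ring.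
  - exact HexU.
  - apply (ex_series_scal (V := R_NormedModule)), Hex, Ht. }
replace (4 * (Rpower (1 / 2) nu / Gamma mu) * Series (PS_derive (PS_incr_1 (q_coef nu))))
  with (Rpower (1 / 2) nu / Gamma mu * (4 * Series (PS_derive (PS_incr_1 (q_coef nu)))))
  by (field; lra).
rewrite Hq, HSU. replace nu with (mu - 1) by (unfold mu; ring). field. lra.
Qed.

Definition tail_weight (m : nat) : R :=
  (INR m + 3) ^ 2 / (4 ^ (m + 2) * INR (fact (m + 2))).

Definition tail_term (mu : R) (m : nat) : R :=
  (-1) ^ m * tail_weight m / poch (mu + 1) (S m).

(** This is [mu q'(1)] for [nu = mu - 1]: the factor [mu] removes the pole at
    [mu = 0], so that the tail is Lipschitz up to there. *)
Definition critical (mu : R) : R := mu - 1 + Series (tail_term mu).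

Lemma tail_weight_pos (m : nat) : 0 < tail_weight m.
Proof.
unfold tail_weight. pose proof (pos_INR m). pose proof (INR_fact_lt_0 (m + 2)).
apply Rdiv_lt_0_compat; [apply pow_lt; lra|].
apply Rmult_lt_0_compat; [apply pow_lt; lra|assumption].
Qed.

Lemma tail_weight_succ (m : nat) : tail_weight (S m) <= 1 / 6 * tail_weight m.
Proof.
unfold tail_weight. replace (S m + 2)%nat with (S (m + 2)) by lia.
rewrite fact_simpl, mult_INR, !S_INR, plus_INR.
change (4 ^ S (m + 2)) with (4 * 4 ^ (m + 2)).
pose proof (pos_INR m). pose proof (INR_fact_lt_0 (m + 2)).
assert (0 < 4 ^ (m + 2)) by (apply pow_lt; lra).
set (x := INR m) in *. set (f := INR (fact (m + 2))) in *. set (w := 4 ^ (m + 2)) in *.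
apply Rmult_le_reg_r with (12 * w * f * (x + 3)).
{ repeat apply Rmult_lt_0_compat; lra. }
change (INR 2) with 2.
replace ((x + 1 + 3) ^ 2 / (4 * w * ((x + 2 + 1) * f)) * (12 * w * f * (x + 3)))
  with (3 * (x + 4) ^ 2) by (field; lra).
replace (1 / 6 * ((x + 3) ^ 2 / (w * f)) * (12 * w * f * (x + 3)))
  with (2 * (x + 3) ^ 3) by (field; lra).
assert (0 <= x * x) by nra. assert (0 <= x * x * x) by nra. nra.
Qed.

Lemma tail_weight_le (k m : nat) : tail_weight (k + m) <= tail_weight k * (1 / 6) ^ m.
Proof.
induction m as [|m IH]; [rewrite Nat.add_0_r; simpl; lra|].
rewrite Nat.add_succ_r. pose proof (tail_weight_succ (k + m)).
change ((1 / 6) ^ S m) with (1 / 6 * (1 / 6) ^ m). lra.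
Qed.

Lemma inv_poch_bounds (mu : R) (m : nat) : 0 < mu -> 0 < / poch (mu + 1) m <= 1.
Proof.
intros Hmu. pose proof (poch_pos (mu + 1) m ltac:(lra)) as Hp.
split; [now apply Rinv_0_lt_compat|].
rewrite <- Rinv_1. apply Rinv_le_contravar; [lra|].
clear Hp. induction m as [|m IH]; simpl; [lra|]. pose proof (pos_INR m). nra.
Qed.

(** By induction: one more factor [1 / (mu + 1 + m)], at most [1/2] and with
    Lipschitz constant at most [1/4], preserves the constant [1]. *)
Lemma inv_poch_lipschitz (mu mu' : R) (m : nat) :
  0 < mu -> 0 < mu' ->
  Rabs (/ poch (mu + 1) (S m) - / poch (mu' + 1) (S m)) <= Rabs (mu - mu').
Proof.
intros Hmu Hmu'. pose proof (Rabs_pos (mu - mu')) as Hd.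
assert (Hinv : forall c, 0 < c ->
  Rabs (/ (mu + c) - / (mu' + c)) <= / (c * c) * Rabs (mu - mu')).
{ intros c Hc.
  replace (/ (mu + c) - / (mu' + c)) with (/ ((mu + c) * (mu' + c)) * - (mu - mu'))
    by (field; lra).
  rewrite Rabs_mult, Rabs_Ropp. apply Rmult_le_compat_r; [exact Hd|].
  rewrite Rabs_pos_eq by (apply Rlt_le, Rinv_0_lt_compat; nra).
  apply Rinv_le_contravar; nra. }
induction m as [|m IH].
- simpl. specialize (Hinv 1 Rlt_0_1).
  replace (/ (1 * (mu + 1 + 0)) - / (1 * (mu' + 1 + 0))) with (/ (mu + 1) - / (mu' + 1))
    by (field; lra).
  rewrite Rmult_1_r, Rinv_1 in Hinv. lra.
- pose proof (inv_poch_bounds mu (S m) Hmu) as H1.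
  pose proof (inv_poch_bounds mu' (S m) Hmu') as H2.
  change (poch (mu + 1) (S (S m))) with (poch (mu + 1) (S m) * (mu + 1 + INR (S m))).
  change (poch (mu' + 1) (S (S m))) with (poch (mu' + 1) (S m) * (mu' + 1 + INR (S m))).
  rewrite !Rinv_mult.
  set (u := / poch (mu + 1) (S m)) in *. set (u' := / poch (mu' + 1) (S m)) in *.
  pose proof (pos_INR m) as Hm. rewrite S_INR.
  set (c := 1 + (INR m + 1)). assert (Hc : 2 <= c) by (unfold c; lra).
  replace (mu + 1 + (INR m + 1)) with (mu + c) by (unfold c; ring).
  replace (mu' + 1 + (INR m + 1)) with (mu' + c) by (unfold c; ring).
  specialize (Hinv c ltac:(lra)).
  replace (u * / (mu + c) - u' * / (mu' + c))
    with ((u - u') * / (mu + c) + u' * (/ (mu + c) - / (mu' + c))) by ring.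
  eapply Rle_trans; [apply Rabs_triang|]. rewrite !Rabs_mult.
  assert (Hb1 : 0 < / (mu + c) <= / 2).
  { split; [apply Rinv_0_lt_compat; lra|apply Rinv_le_contravar; lra]. }
  assert (Hb2 : / (c * c) <= / 4) by (apply Rinv_le_contravar; nra).
  rewrite (Rabs_pos_eq (/ (mu + c))), (Rabs_pos_eq u') by lra.
  assert (Rabs (u - u') * / (mu + c) <= Rabs (mu - mu') * / 2)
    by (apply Rmult_le_compat; try lra; apply Rabs_pos).
  assert (u' * Rabs (/ (mu + c) - / (mu' + c)) <= 1 * (/ 4 * Rabs (mu - mu'))).
  { apply Rmult_le_compat; try lra; [apply Rabs_pos|].
    eapply Rle_trans; [exact Hinv|]. apply Rmult_le_compat_r; assumption. }
  lra.
Qed.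

Lemma tail_term_le (mu : R) (k m : nat) :
  0 < mu -> Rabs (tail_term mu (k + m)) <= tail_weight k * (1 / 6) ^ m.
Proof.
intros Hmu. unfold tail_term, Rdiv.
rewrite !Rabs_mult, pow_1_abs, Rmult_1_l.
pose proof (inv_poch_bounds mu (S (k + m)) Hmu). pose proof (tail_weight_pos (k + m)).
rewrite !Rabs_pos_eq by lra.
eapply Rle_trans; [|apply tail_weight_le]. nra.
Qed.

Lemma ex_series_tail_term (mu : R) : 0 < mu -> ex_series (tail_term mu).
Proof.
intros Hmu. apply (Series_Rabs_geom_le (tail_term mu) (tail_weight 0) (1 / 6)); [lra|].
intros m. exact (tail_term_le mu 0 m Hmu).
Qed.

Lemma tail_weight_0 : tail_weight 0 = 9 / 32.
Proof. unfold tail_weight. simpl. field. Qed.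

Lemma critical_tail_lipschitz (mu mu' : R) :
  0 < mu -> 0 < mu' ->
  Rabs (Series (tail_term mu) - Series (tail_term mu')) <= 1 / 2 * Rabs (mu - mu').
Proof.
intros Hmu Hmu'.
rewrite <- Series_minus by (apply ex_series_tail_term; assumption).
pose proof (Rabs_pos (mu - mu')) as Hd.
destruct (Series_Rabs_geom_le (fun m => tail_term mu m - tail_term mu' m)
  (9 / 32 * Rabs (mu - mu')) (1 / 6)) as [_ H]; [lra| |lra].
intros m. unfold tail_term, Rdiv.
rewrite <- Rmult_minus_distr_l, !Rabs_mult, pow_1_abs, Rmult_1_l.
pose proof (inv_poch_lipschitz mu mu' m Hmu Hmu').
pose proof (tail_weight_pos m). rewrite (Rabs_pos_eq (tail_weight m)) by lra.
pose proof (tail_weight_le 0 m) as Hw. rewrite tail_weight_0 in Hw.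
change (0 + m)%nat with m in Hw.
apply Rle_trans with (9 / 32 * (1 / 6) ^ m * Rabs (mu - mu')); [|right; unfold Rdiv; ring].
apply Rmult_le_compat; try lra. apply Rabs_pos.
Qed.

Lemma critical_increasing (mu mu' : R) :
  0 < mu -> mu < mu' -> critical mu < critical mu'.
Proof.
intros Hmu Hlt. pose proof (critical_tail_lipschitz mu mu' Hmu ltac:(lra)) as H.
rewrite (Rabs_left (mu - mu')) in H by lra. apply Rabs_le_between in H.
unfold critical. lra.
Qed.

Lemma continuity_pt_critical (mu : R) : 0 < mu -> continuity_pt critical mu.
Proof.
intros Hmu eps Heps. exists (Rmin mu (eps / 2)).
split; [apply Rmin_pos; lra|]. intros x [_ Hx].
simpl in Hx. unfold R_dist in Hx.
pose proof (Rmin_l mu (eps / 2)). pose proof (Rmin_r mu (eps / 2)).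
assert (Hx0 : 0 < x) by (apply Rabs_def2 in Hx; lra).
pose proof (critical_tail_lipschitz x mu Hx0 Hmu) as H1.
simpl. unfold R_dist, critical.
replace (x - 1 + Series (tail_term x) - (mu - 1 + Series (tail_term mu)))
  with ((x - mu) + (Series (tail_term x) - Series (tail_term mu))) by ring.
eapply Rle_lt_trans; [apply Rabs_triang|]. lra.
Qed.

Lemma critical_q_derivative (nu : R) :
  -1 < nu ->
  critical (nu + 1) = (nu + 1) * PSeries (PS_derive (PS_incr_1 (q_coef nu))) 1.
Proof.
intros Hnu. set (A := PS_derive (PS_incr_1 (q_coef nu))).
assert (HA : entire A) by (apply entire_derive, entire_incr_1, entire_q_coef, Hnu).
assert (HAn : forall n, A n = (INR n + 1) ^ 2 * bessel_coef (nu + 1) n).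
{ intros n. unfold A. rewrite PS_derive_incr_1, q_coef_bessel_coef by exact Hnu. ring. }
assert (Hex := ex_series_entire_at_1 A HA).
unfold PSeries. rewrite Series_incr_1 by exact Hex.
rewrite Series_incr_1 by (apply (ex_series_incr_1 (fun n => A n * 1 ^ n)); exact Hex).
rewrite !Rmult_plus_distr_l, <- Series_scal_l.
rewrite (HAn 0%nat), (HAn 1%nat), (bessel_coef_succ _ 0), bessel_coef_0 by lra.
unfold critical. rewrite <- Rplus_assoc. f_equal.
- simpl. field. lra.
- apply Series_ext. intros m. rewrite HAn, pow1, Rmult_1_r.
  unfold tail_term, tail_weight, bessel_coef.
  replace (m + 2)%nat with (S (S m)) by lia.
  rewrite (poch_succ_l (nu + 1)). rewrite !S_INR.
  change ((-1) ^ S (S m)) with (-1 * (-1 * (-1) ^ m)).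
  pose proof (poch_pos (nu + 1 + 1) (S m) ltac:(lra)).
  pose proof (INR_fact_neq_0 (S (S m))).
  assert (4 ^ S (S m) <> 0) by (apply pow_nonzero; lra).
  field. repeat split; lra.
Qed.

(** The first omitted term is at most [49 / 2949120] and the next ones decrease by a
    factor [6] at least.  The precision is chosen to be finer than the values of
    [critical] at the two test points below, about [-0.000036] and [0.000056]. *)
Lemma critical_approx (mu : R) :
  0 < mu ->
  Rabs (critical mu
    - (mu - 1 + (tail_term mu 0 + tail_term mu 1 + tail_term mu 2 + tail_term mu 3)))
  <= 1 / 50000.
Proof.
intros Hmu. unfold critical.
pose proof (ex_series_tail_term mu Hmu) as H0.
assert (H1 := proj1 (ex_series_incr_1 (tail_term mu)) H0).
assert (H2 := proj1 (ex_series_incr_1 _) H1).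
assert (H3 := proj1 (ex_series_incr_1 _) H2).
rewrite (Series_incr_1 _ H0), (Series_incr_1 _ H1), (Series_incr_1 _ H2), (Series_incr_1 _ H3).
destruct (Series_Rabs_geom_le (fun m => tail_term mu (S (S (S (S m))))) (tail_weight 4) (1 / 6))
  as [_ Hle]; [lra| |].
{ intros m. exact (tail_term_le mu 4 m Hmu). }
match goal with |- Rabs ?v <= _ =>
  replace v with (Series (fun m => tail_term mu (S (S (S (S m)))))) by ring end.
eapply Rle_trans; [exact Hle|]. unfold tail_weight. simpl. lra.
Qed.

Lemma critical_signs : critical (8561 / 10000) < 0 < critical (8562 / 10000).
Proof.
split.
- pose proof (critical_approx (8561 / 10000) ltac:(lra)) as H.
  unfold tail_term, tail_weight in H. simpl in H. apply Rabs_le_between in H. lra.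
- pose proof (critical_approx (8562 / 10000) ltac:(lra)) as H.
  unfold tail_term, tail_weight in H. simpl in H. apply Rabs_le_between in H. lra.
Qed.

Theorem theorem1 :
  exists nu_star : R,
    unique (fun nu : R =>
              -1 < nu /\
              3 * BesselJ nu 1 + 2 * (nu - 2) * BesselJ (nu + 1) 1 = 0)
           nu_star /\
    -0.1439 < nu_star <= -0.1438 /\
    forall nu : R, -1 < nu ->
      (forall x : R, 0 < x < 1 -> q nu (RtoC x) = RtoC (q_bessel nu x)) /\
      ((starlike (q nu) /\
        (forall k : nat, (1 <= k)%nat -> close_to_convex (C_derive_n (q nu) k)))
       <-> nu_star <= nu) /\
      (forall k : nat, (1 <= k)%nat ->
         close_to_convex (C_derive_n (q nu) k) ->
         univalent (C_derive_n (q nu) k)).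
Proof.
destruct critical_signs as [Hneg Hpos].
destruct (Ranalysis5.IVT_interv critical (8561 / 10000) (8562 / 10000)) as [mus [Hmus Hroot]];
  try lra.
{ intros a Ha. apply continuity_pt_critical. lra. }
assert (Hb1 : mus <> 8561 / 10000) by (intros E; rewrite E in Hroot; lra).
assert (Heq : forall nu, -1 < nu ->
  (3 * BesselJ nu 1 + 2 * (nu - 2) * BesselJ (nu + 1) 1 = 0 <-> critical (nu + 1) = 0)).
{ intros nu Hnu.
  rewrite bessel_equation_q_derivative, critical_q_derivative by exact Hnu.
  pose proof (Gamma_pos (nu + 1) ltac:(lra)). pose proof (Rpower_pos (1 / 2) nu).
  assert (0 < Rpower (1 / 2) nu / Gamma (nu + 1)) by (apply Rdiv_lt_0_compat; assumption).
  split; intros E; apply Rmult_integral in E; destruct E as [E|E]; try lra;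
    rewrite E; ring. }
assert (Hsign : forall nu, -1 < nu ->
  (0 <= PSeries (PS_derive (PS_incr_1 (q_coef nu))) 1 <-> mus - 1 <= nu)).
{ intros nu Hnu. pose proof (critical_q_derivative nu Hnu) as Hc. split; intros H.
  - apply Rnot_lt_le; intros Hlt.
    pose proof (critical_increasing (nu + 1) mus ltac:(lra) ltac:(lra)). nra.
  - assert (0 <= critical (nu + 1)).
    { destruct H as [H|H].
      - pose proof (critical_increasing mus (nu + 1) ltac:(lra) ltac:(lra)). lra.
      - replace (nu + 1) with mus by lra. lra. }
    rewrite Hc in H0. apply Rmult_le_reg_l with (nu + 1); lra. }
exists (mus - 1). split; [split|split].
- split; [lra|]. apply Heq; [lra|]. replace (mus - 1 + 1) with mus by ring. exact Hroot.
- intros nu [Hnu E]. apply Heq in E; [|exact Hnu].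
  destruct (Rtotal_order (nu + 1) mus) as [H|[H|H]]; [|lra|].
  + pose proof (critical_increasing (nu + 1) mus ltac:(lra) H). lra.
  + pose proof (critical_increasing mus (nu + 1) ltac:(lra) H). lra.
- lra.
- intros nu Hnu. split; [|split].
  + intros x Hx. now apply q_eq_q_bessel.
  + split.
    * intros [[Hu _] _]. apply Hsign; [exact Hnu|].
      now apply q_univalent_derivative_at_1.
    * intros Hle. split.
      -- apply q_starlike; [lra|]. apply Hsign; assumption.
      -- intros k Hk. apply q_derivatives_close_to_convex; [lra|exact Hk].
  + intros k _. apply close_to_convex_univalent.
Qed.
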